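(* Let $P\subset\mathbb{R}^d$ be a polytope and let $Z_0\in\mathcal{Z}_n(\mathbb{R}^d)$ be such that (1) $Z_0$ is a general position zonotope, and (2) each vertex of $P$ is Hausdorff stable relative to $Z_0$ and each vertex of $Z_0$ is Hausdorff stable relative to $P$. For $p\in\mathrm{Vert}(P)$ let $F_p$ be the smallest face of $Z_0$ containing $\Pi(p,Z_0)$, and for $q\in\mathrm{Vert}(Z_0)$ let $F_q$ be the smallest face of $P$ containing $\Pi(q,P)$. Then there exists an open neighborhood $U$ of $Z_0$ in $\mathcal{Z}_n(\mathbb{R}^d)$ such that for all $Z\in U$ $$d_P(Z)=\max\Big(\max_{p\in\mathrm{Vert}(P)} d\big(p,\mathrm{Aff}(\varphi_Z(F_p))\big),\ \max_{q\in\mathrm{Vert}(Z_0)} d\big(\varphi_Z(q),\mathrm{Aff}(F_q)\big)\Big),$$ where $\varphi_Z:\partial Z_0\to\partial Z$ is the pushforward map. Moreover, each term in the maximum above is a square root of a bounded rational function in the parameters $(Q,\mu)$ defining $Z$. In particular, the terms are differentiable functions of $Z$ inside $U$.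
   Context: For a matrix $Q\in\mathbb{R}^{d\times n}$ with columns $g_1,\dots,g_n$ (the generators) and $\mu\in\mathbb{R}^d$, let $A(x)=Qx+\mu$, let $I^n=[0,1]^n$, and let $Z(Q,\mu)=A(I^n)\subset\mathbb{R}^d$ be the associated zonotope. The space of zonotopes $\mathcal{Z}_n(\mathbb{R}^d)$ is the quotient of the space of pairs $(Q,\mu)\in\mathbb{R}^{d\times n}\times\mathbb{R}^d$ by the action of $S_n$ permuting the columns of $Q$. Near $Z_0=Z(Q_0,\mu_0)$ one works with a fixed representative $(Q_0,\mu_0)$ and with the representatives $(Q,\mu)$ of nearby zonotopes $Z$ that are close to $(Q_0,\mu_0)$; ''functions of $Z$'' means functions of $(Q,\mu)$. A zonotope is a general position zonotope if its generators are in general position (any subset of at most $d$ of the generators is linearly independent). For such $Z_0$, with $A_0(x)=Q_0x+\mu_0$, every $q\in\partial Z_0$ has a unique preimage $\mathrm{Lift}(q)$ in $A_0^{-1}(q)\cap I^n$. The pushforward map to $Z=Z(Q,\mu)$ is $\varphi_Z(q)=Q\,\mathrm{Lift}(q)+\mu$ for $q\in\partial Z_0$; it takes values in $Z$, and it is called proper if its image lies in $\partial Z$ (which holds for $Z$ near $Z_0$). If $F_p=Z_0$, then $\mathrm{Aff}(\varphi_Z(F_p))$ is understood as $\mathrm{Aff}(Z)$. $d$ is Euclidean distance (point to set); $d(P,Z)=\max(\sup_{p\in P}d(p,Z),\sup_{z\in Z}d(z,P))$ is the Hausdorff distance, and $d_P(Z)=d(P,Z)$. $\Pi(x,W)$ is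 the Euclidean nearest point to $x$ in a closed convex set $W$; $\mathrm{Aff}$ is affine hull; $\mathrm{Vert}$ is the vertex set. A polytope is a face of itself. For a polytope $X\subset\mathbb{R}^d$, a point $x\notin X^\circ$ (the interior) is Hausdorff stable relative to $X$ if $x-\Pi(x,X)$ lies in the relative interior of the normal cone to $X$ at $\Pi(x,X)$; every point $x\in X^\circ$ is also Hausdorff stable relative to $X$.
   Formalization: Differentiability of a term is claimed only if its vertex lies outside the other polytope (Z_0 or P) or that polytope has nonempty interior; otherwise the term is a distance to a proper affine subspace, vanishing at Z_0, and is not differentiable there (it behaves like |t|). *)

(* Defs.v *)
From HB Require Import structures.
From mathcomp Require Import all_boot all_order all_algebra.
From mathcomp Require Import all_classical all_reals all_analysis.
From mathcomp Require mpoly.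

Set Implicit Arguments.
Unset Strict Implicit.
Unset Printing Implicit Defensive.

Import Order.TTheory GRing.Theory Num.Theory.
Import numFieldNormedType.Exports.

Local Open Scope classical_set_scope.
Local Open Scope ring_scope.

(* Points of R^d are column vectors.  The library norm on matrices is the sup
   norm: it is used only through the topology (open, interior, closure) and
   differentiability, which do not depend on the choice of a norm.  All metric
   notions below use the Euclidean norm [enorm]. *)

Section Geometry.
Variables (R : realType) (d : nat).
Implicit Types (X Y : set 'cV[R]_d) (x y u : 'cV[R]_d).

Definition dot x y : R := (x^T *m y) 0 0.

Definition enorm x : R := Num.sqrt (dot x x).

Definition dist x X : R := inf [set enorm (x - y) | y in X].

Definition hausdorff_dist X Y : R :=
  Num.max (sup [set dist x Y | x in X]) (sup [set dist y X | y in Y]).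

(* the Euclidean nearest point (unique when X is nonempty, closed, convex) *)
Definition nearest_pt x X : 'cV[R]_d :=
  xget 0 [set y | X y /\ forall z, X z -> enorm (x - y) <= enorm (x - z)].

Definition Aff X : set 'cV[R]_d :=
  [set y | exists (m : nat) (a : 'I_m -> R) (v : 'I_m -> 'cV[R]_d),
     [/\ forall i, X (v i), \sum_i a i = 1 & y = \sum_i a i *: v i]].

Definition is_polytope X : Prop :=
  exists (m : nat) (v : 'I_m.+1 -> 'cV[R]_d),
    X = [set y | exists a : 'I_m.+1 -> R,
           [/\ forall i, 0 <= a i, \sum_i a i = 1 & y = \sum_i a i *: v i]].

(* Faces are the sets of maximizers of linear functionals; the zero functional
   makes X a face of itself. *)
Definition is_face X (F : set 'cV[R]_d) : Prop :=
  exists u, F = [set x | X x /\ forall y, X y -> dot u y <= dot u x].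

Definition Vert X : set 'cV[R]_d := [set v | is_face X [set v]].

(* The faces of a polytope are stable under nonempty intersection, so this is
   a face when X is a polytope and X x holds. *)
Definition smallest_face X x : set 'cV[R]_d :=
  \bigcap_(F in [set F | is_face X F /\ F x]) F.

Definition normal_cone X x : set 'cV[R]_d :=
  [set u | forall y, X y -> dot u (y - x) <= 0].

Definition relint X : set 'cV[R]_d :=
  [set x | X x /\ exists2 e : R, 0 < e &
                  forall y, Aff X y -> enorm (y - x) < e -> X y].

Definition frontier X : set 'cV[R]_d := closure X `\` X°.

Definition hausdorff_stable X x : Prop :=
  X° x \/ (~ X° x /\ relint (normal_cone X (nearest_pt x X)) (x - nearest_pt x X)).

End Geometry.

Section Zonotopes.
Variables (R : realType) (d n : nat).
Implicit Types (Q : 'M[R]_(d, n)) (mu : 'cV[R]_d).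

Definition cube : set 'cV[R]_n := [set x | forall i, 0 <= x i 0 <= 1].

Definition zonotope Q mu : set 'cV[R]_d := [set Q *m x + mu | x in cube].

(* The generators are indexed by 'I_n, so a repeated column is a linearly
   dependent pair. *)
Definition general_position Q : Prop :=
  forall S : {set 'I_n}, (#|S| <= d)%N -> free [seq col i Q | i <- enum S].

(* meaningful for q in frontier (zonotope Q0 mu0), where the preimage is
   unique if Q0 is in general position *)
Definition lift_pt Q0 mu0 (q : 'cV[R]_d) : 'cV[R]_n :=
  xget 0 [set x | cube x /\ Q0 *m x + mu0 = q].

Definition zpushforward Q0 mu0 Q mu (q : 'cV[R]_d) : 'cV[R]_d :=
  Q *m lift_pt Q0 mu0 q + mu.

(* Aff(phi_Z(F)), with its convention for the improper face *)
Definition aff_push Q0 mu0 Q mu (F : set 'cV[R]_d) : set 'cV[R]_d :=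
  if `[< F = zonotope Q0 mu0 >] then Aff (zonotope Q mu)
  else Aff (zpushforward Q0 mu0 Q mu @` F).

Definition term_P Q0 mu0 (p : 'cV[R]_d) Q mu : R :=
  dist p (aff_push Q0 mu0 Q mu
            (smallest_face (zonotope Q0 mu0) (nearest_pt p (zonotope Q0 mu0)))).

Definition term_Z Q0 mu0 (P : set 'cV[R]_d) (q : 'cV[R]_d) Q mu : R :=
  dist (zpushforward Q0 mu0 Q mu q) (Aff (smallest_face P (nearest_pt q P))).

(* the d * n + d real parameters: the entries of Q, then those of mu *)
Definition params Q mu : 'rV[R]_(d * n + d) := row_mx (mxvec Q) mu^T.

Definition sqrt_bounded_rational (U : set ('M[R]_(d, n) * 'cV[R]_d))
    (f : 'M[R]_(d, n) -> 'cV[R]_d -> R) : Prop :=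
  exists (N D : mpoly.mpoly (d * n + d) R) (M : R),
    forall Q mu, U (Q, mu) ->
      let val p := mpoly.meval (fun i => params Q mu 0 i) p in
      [/\ val D != 0, 0 <= val N / val D <= M
        & f Q mu = Num.sqrt (val N / val D)].

End Zonotopes.

(* Main.v *)
Require Import Defs.
From HB Require Import structures.
From mathcomp Require Import all_boot all_order all_algebra.
From mathcomp Require Import all_classical all_reals all_analysis.
From mathcomp Require Import ring lra.
From mathcomp Require mpoly.

Import Order.TTheory GRing.Theory Num.Theory.
Import numFieldNormedType.Exports.
Import (canonicals, hints, coercions) mpoly.

(** Why the formula holds.  Write [A x = Q *m x + mu] and let [p] be a vertex of
[P], with nearest point [pi] on the zonotope of [(Q0, mu0)] and displacement
[u0 = p - pi].  The face [F] exposed by [u0] consists of the images of the points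
of the cube that agree with a lift [x0] of [pi] outside the set [I0] of the
generators orthogonal to [u0].  Stability of [p] has two consequences.  First,
[F] is the smallest face containing [pi] ([smallest_faceE]), since [u0] can be
moved away from any other normal at [pi] without leaving the normal cone.
Second, the coordinates of [x0] in [I0] lie strictly between 0 and 1
([lift_strictly_inside]), since otherwise some tilt of [u0] would be a normal
from which [u0] could not be moved away.  General position makes the generators in [I0] independent unless [p] is
an interior point.  For [(Q, mu)] near [(Q0, mu0)] the orthogonal projection of
[p] on the affine hull of the pushed forward face is therefore given by normal
equations with an invertible Gram matrix, hence by rational functions of the
parameters; its coordinates are still in the cube, and the displacement still
has the right strict signs on the generators outside [I0], so the projection is
the nearest point of the zonotope.  Its distance to [p] is the square root of a
rational function ([term_P_near]).  An interior [p] stays interior, and its term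
is 0.

The terms of the vertices [q] of the zonotope are dual and easier, because [P]
is fixed: the projector on the affine hull of a face of [P] is constant and
[q] is pushed forward to an affine function of the parameters.  That the nearest
point stays in the face needs a representation of the nearest point with positive
weights on all generators of the face; it comes from stability and Farkas' lemma
([relint_positive_weights], [term_Z_near]).

It remains to see that the Hausdorff distance is attained at vertices.  If [u] is
the displacement of a point [z] from a convex body, any point at least as far in
the direction [u] is at least as distant ([le_dist_direction]); so it is enough
that every nonzero functional is maximized over [P] at a vertex
([vertex_maximizing]), and over a nearby zonotope at a pushed forward vertex
([vertices_dominate_near]).  The latter says that no new sign pattern of a
functional on the generators appears: a pattern that does not occur for [Q0],
even weakly, is excluded uniformly on the unit sphere, and a pattern that occurs
weakly occurs strictly by general position ([perturb_normal]).  The same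
perturbation shows that boundary points are pushed forward to boundary points
([proper_near]).

Differentiability is lost only where the square root of a rational function
vanishes.  In the cases of the statement a term that vanishes at [(Q0, mu0)]
vanishes identically nearby. *)

Set Implicit Arguments.
Unset Strict Implicit.
Unset Printing Implicit Defensive.

Local Open Scope classical_set_scope.
Local Open Scope ring_scope.

(** * Euclidean geometry of column vectors *)

Section EuclideanSpace.
Variables (R : realType) (d : nat).
Implicit Types (x y z u v w : 'cV[R]_d) (X Y : set 'cV[R]_d).

Lemma dotE x y : dot x y = \sum_i x i 0 * y i 0.
Proof. by rewrite /dot mxE; apply: eq_bigr => i _; rewrite mxE. Qed.

Lemma dotC x y : dot x y = dot y x.
Proof. by rewrite !dotE; apply: eq_bigr => i _; rewrite mulrC. Qed.

Lemma dotDl x y z : dot (x + y) z = dot x z + dot y z.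
Proof. by rewrite /dot linearD mulmxDl mxE. Qed.

Lemma dotDr x y z : dot x (y + z) = dot x y + dot x z.
Proof. by rewrite dotC dotDl ![dot _ x]dotC. Qed.

Lemma dotZl a x y : dot (a *: x) y = a * dot x y.
Proof. by rewrite /dot linearZ /= -scalemxAl mxE. Qed.

Lemma dotZr a x y : dot x (a *: y) = a * dot x y.
Proof. by rewrite dotC dotZl dotC. Qed.

Lemma dotNl x y : dot (- x) y = - dot x y.
Proof. by rewrite -scaleN1r dotZl mulN1r. Qed.

Lemma dotNr x y : dot x (- y) = - dot x y.
Proof. by rewrite dotC dotNl dotC. Qed.

Lemma dotBl x y z : dot (x - y) z = dot x z - dot y z.
Proof. by rewrite dotDl dotNl. Qed.

Lemma dotBr x y z : dot x (y - z) = dot x y - dot x z.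
Proof. by rewrite dotDr dotNr. Qed.

Lemma dot0l x : dot 0 x = 0.
Proof. by rewrite -(scale0r 0) dotZl mul0r. Qed.

Lemma dot0r x : dot x 0 = 0.
Proof. by rewrite dotC dot0l. Qed.

Lemma dot_sumr (I : Type) (r : seq I) (Pr : pred I) x (F : I -> 'cV[R]_d) :
  dot x (\sum_(i <- r | Pr i) F i) = \sum_(i <- r | Pr i) dot x (F i).
Proof.
elim/big_rec2: _ => [|i y1 y2 _ <-]; first exact: dot0r.
by rewrite dotDr.
Qed.

Lemma dot_suml (I : Type) (r : seq I) (Pr : pred I) x (F : I -> 'cV[R]_d) :
  dot (\sum_(i <- r | Pr i) F i) x = \sum_(i <- r | Pr i) dot (F i) x.
Proof. by rewrite dotC dot_sumr; apply: eq_bigr => i _; rewrite dotC. Qed.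

Lemma dot_ge0 x : 0 <= dot x x.
Proof. by rewrite dotE sumr_ge0 // => i _; rewrite -expr2 sqr_ge0. Qed.

Lemma dot_eq0 x : (dot x x == 0) = (x == 0).
Proof.
apply/eqP/eqP => [|->]; last exact: dot0l.
rewrite dotE => /eqP; rewrite psumr_eq0 => [|i _]; last by rewrite -expr2 sqr_ge0.
move=> /allP x0; apply/matrixP => i j; rewrite ord1 mxE.
by have := x0 i (mem_index_enum i); rewrite -expr2 sqrf_eq0 => /eqP.
Qed.

Lemma dot_gt0 x : (0 < dot x x) = (x != 0).
Proof. by rewrite lt_neqAle dot_ge0 andbT eq_sym dot_eq0. Qed.

Lemma enorm_ge0 x : 0 <= enorm x.
Proof. exact: sqrtr_ge0. Qed.

Lemma enorm_sqr x : enorm x ^+ 2 = dot x x.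
Proof. by rewrite sqr_sqrtr // dot_ge0. Qed.

Lemma enorm_gt0 x : (0 < enorm x) = (x != 0).
Proof. by rewrite sqrtr_gt0 dot_gt0. Qed.

Lemma enorm0 : enorm (0 : 'cV[R]_d) = 0.
Proof. by rewrite /enorm dot0l sqrtr0. Qed.

Lemma le_enorm x y : (enorm x <= enorm y) = (dot x x <= dot y y).
Proof. by rewrite ler_sqrt // dot_ge0. Qed.

Lemma enormZ a x : enorm (a *: x) = `|a| * enorm x.
Proof. by rewrite /enorm dotZl dotZr mulrA -expr2 sqrtrM ?sqr_ge0 // sqrtr_sqr. Qed.

Lemma enormN x : enorm (- x) = enorm x.
Proof. by rewrite /enorm dotNl dotNr opprK. Qed.

Lemma cauchy_schwarz x y : dot x y <= enorm x * enorm y.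
Proof.
have [->|y0] := eqVneq y 0; first by rewrite dot0r enorm0 mulr0.
have yy : 0 < dot y y by rewrite dot_gt0.
(* the residual of [x] along [y], scaled to avoid a division *)
have: 0 <= dot (dot y y *: x - dot x y *: y) (dot y y *: x - dot x y *: y).
  exact: dot_ge0.
rewrite !dotBl !dotBr !dotZl !dotZr (dotC y x) => h.
have {}h : dot x y ^+ 2 <= dot x x * dot y y.
  by rewrite -(ler_pM2l yy); nra.
rewrite (le_trans (ler_norm _)) // -sqrtrM ?dot_ge0 // -sqrtr_sqr.
by rewrite ler_sqrt // mulr_ge0 ?dot_ge0.
Qed.

Lemma abs_coord_le_enorm x i : `|x i 0| <= enorm x.
Proof.
rewrite -sqrtr_sqr ler_sqrt ?dot_ge0 // dotE (bigD1 i) //= -expr2 lerDl.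
by rewrite sumr_ge0 // => j _; rewrite -expr2 sqr_ge0.
Qed.

End EuclideanSpace.

Lemma dot_mulmx (R : realType) (m k : nat) (A : 'M[R]_(m, k)) x y :
  dot (A *m x) y = dot x (A^T *m y).
Proof. by rewrite /dot trmx_mul mulmxA. Qed.

(** * Continuity, and compactness of the cube *)

Section Topology.
Variable R : realType.

Lemma near_lt (T : topologicalType) (f g : T -> R) x :
  {for x, continuous f} -> {for x, continuous g} -> f x < g x ->
  \forall t \near x, f t < g t.
Proof.
move=> fc gc; rewrite -subr_gt0 => fg.
have h : {for x, continuous (g - f)} by exact: continuousB.
have : \forall t \near x, 0 < (g - f) t by exact: (cvgr_gt ((g - f) x)).
by apply: filterS => t; rewrite !fctE subr_gt0.
Qed.

Lemma continuous_mx (T : topologicalType) (m k : nat) (f : T -> 'M[R]_(m, k)) x :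
  (forall i j, {for x, continuous (fun t => f t i j)}) -> {for x, continuous f}.
Proof.
move=> fc; apply/cvg_ballP => e e0.
have : \forall t \near x, forall ij : 'I_m * 'I_k, ball (f x ij.1 ij.2) e (f t ij.1 ij.2).
  apply: filter_forall => -[i j] /=.
  have := fc i j; move/cvg_ballP; exact.
apply: filterS => t ht; split=> // i j; exact: (ht (i, j)).
Qed.

Lemma continuous_sumr (T : topologicalType) (I : Type) (r : seq I) (Pr : pred I)
    (F : I -> T -> R) x :
  (forall i, {for x, continuous (F i)}) ->
  {for x, continuous (fun t => \sum_(i <- r | Pr i) F i t)}.
Proof.
move=> Fc; elim: r => [|i r IH].
  under [X in {for _, continuous X}]eq_fun do rewrite big_nil.
  exact: cst_continuous.
under [X in {for _, continuous X}]eq_fun do rewrite big_cons.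
case: (Pr i) => //; exact: continuousD.
Qed.

Lemma continuous_dot (T : topologicalType) (d : nat) (f g : T -> 'cV[R]_d) x :
  {for x, continuous f} -> {for x, continuous g} ->
  {for x, continuous (fun t => dot (f t) (g t))}.
Proof.
move=> fc gc.
under [X in {for _, continuous X}]eq_fun do rewrite dotE.
apply: continuous_sumr => i; apply: continuousM.
  apply: (@continuous_comp _ _ _ f (fun v : 'cV_d => v i 0)) => //.
  exact: coord_continuous.
apply: (@continuous_comp _ _ _ g (fun v : 'cV_d => v i 0)) => //.
exact: coord_continuous.
Qed.

Lemma continuous_mulmxl (m k p : nat) (A : 'M[R]_(m, k)) :
  continuous (fun B : 'M[R]_(k, p) => A *m B).
Proof.
move=> B; apply: continuous_mx => i j.
under [X in {for _, continuous X}]eq_fun do rewrite mxE.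
apply: continuous_sumr => l; apply: continuousM; first exact: cst_continuous.
exact: coord_continuous.
Qed.

Lemma continuous_enorm (d : nat) : continuous (@enorm R d).
Proof.
move=> x; apply: (@continuous_comp _ _ _ (fun x : 'cV[R]_d => dot x x)).
  by apply: continuous_dot; exact: cvg_id.
exact: sqrt_continuous.
Qed.

Lemma compact_cube (n : nat) : compact (@cube R n).
Proof.
have -> : @cube R n = trmx @` [set v : 'rV[R]_n | forall i, v ord0 i \in `[0, 1]].
  apply/seteqP; split=> [x xc|_ [v vc <-] i].
    exists x^T; last by rewrite trmxK.
    by move=> i; rewrite in_itv /= mxE; exact: xc.
  by have := vc i; rewrite in_itv /= mxE.
apply: continuous_compact; last first.
  have h := @rV_compact R n (fun=> `[0 : R, 1]%classic) (fun=> @segment_compact _ _ _).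
  exact: h.
apply: continuous_subspaceT => v; apply: continuous_mx => i j.
under [X in {for _, continuous X}]eq_fun do rewrite mxE.
exact: coord_continuous.
Qed.

(** Connects the topology, given by the sup norm, with Euclidean balls. *)
Lemma interior_enormP (d : nat) (X : set 'cV[R]_d) x :
  X° x <-> exists2 r : R, 0 < r & forall y, enorm (y - x) < r -> X y.
Proof.
split=> [/nbhs_ballP[r r0 rX]|[r r0 rX]].
  exists r => // y yr; apply: rX; split=> // i j; rewrite ord1 /ball /= distrC.
  by apply: le_lt_trans yr; have := abs_coord_le_enorm (y - x) i; rewrite !mxE.
have c : {for x, continuous (fun y : 'cV[R]_d => enorm (y - x))}.
  apply: (@continuous_comp _ _ _ (fun y : 'cV[R]_d => y - x)).
    by apply: continuousB; [exact: cvg_id|exact: cst_continuous].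
  exact: continuous_enorm.
have lt_r : enorm (x - x) < r by rewrite subrr enorm0.
have := near_lt c (@cst_continuous _ _ r _) lt_r.
by apply: filterS => y; exact: rX.
Qed.

End Topology.

(** * Convex bodies, nearest points, and faces *)

Lemma small_multiple (R : realFieldType) (I : finType) (b c : I -> R) :
  (forall i, 0 < c i) -> exists2 e : R, 0 < e & forall i, e * b i < c i.
Proof.
move=> c0; pose s := \sum_i `|b i| / c i.
have s0 : 0 <= s by rewrite sumr_ge0 // => i _; rewrite divr_ge0 // ltW.
have s1 : 0 < 1 + s by rewrite ltr_pwDl.
(* [e * b i < c i] amounts to [b i < c i * (1 + s)], and [c i * s >= `|b i|] *)
exists (1 + s)^-1; first by rewrite invr_gt0.
move=> i; rewrite mulrC ltr_pdivrMr // mulrDr mulr1.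
have : `|b i| <= c i * s.
  rewrite mulrC -ler_pdivrMr // /s (bigD1 i) //= lerDl sumr_ge0 // => j _.
  by rewrite divr_ge0 // ltW.
by have := c0 i; have := ler_norm (b i); lra.
Qed.

Section ConvexSets.
Variables (R : realType) (d : nat).
Implicit Types (x y z u w : 'cV[R]_d) (X Y : set 'cV[R]_d).

(** Closedness under segments is stated on the form [x + t *: (y - x)], along
which distances are expanded below. *)
Definition convex_body X :=
  [/\ X !=set0, compact X &
      forall x y t, X x -> X y -> 0 <= t <= 1 -> X (x + t *: (y - x))].

(** The variational inequality, which characterizes the nearest point of a convex
set and, unlike minimality, is linear in the competitor [z]. *)
Definition is_proj X x y :=
  X y /\ forall z, X z -> dot (x - y) (z - y) <= 0.

Lemma dist_minimizer X x y :
  X y -> (forall z, X z -> enorm (x - y) <= enorm (x - z)) ->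
  dist x X = enorm (x - y).
Proof.
move=> Xy ymin; apply/eqP; rewrite eq_le; apply/andP; split.
  apply: ge_inf; last by exists y.
  by exists 0 => _ [z _ <-]; exact: enorm_ge0.
apply: lb_le_inf; first by exists (enorm (x - y)), y.
by move=> _ [z Xz <-]; exact: ymin.
Qed.

Lemma is_proj_min X x y : is_proj X x y ->
  forall z, X z -> enorm (x - y) <= enorm (x - z).
Proof.
move=> [_ py] z Xz; rewrite le_enorm.
have -> : x - z = (x - y) - (z - y) by rewrite opprB addrA subrK.
have := py z Xz; have := dot_ge0 (z - y).
move: (x - y) (z - y) => p q; rewrite dotBl !dotBr (dotC q p); lra.
Qed.

Lemma dist_proj X x y : is_proj X x y -> dist x X = enorm (x - y).
Proof. by move=> p; apply: dist_minimizer (is_proj_min p); case: p. Qed.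

Lemma is_proj_id X x : X x -> is_proj X x x.
Proof. by move=> Xx; split=> // z _; rewrite subrr dot0l. Qed.

Lemma dist_in X x : X x -> dist x X = 0.
Proof. by move=> /is_proj_id/dist_proj ->; rewrite subrr enorm0. Qed.

(** A competitor [z] with positive product could be approached from the nearest
point [n] along a short segment, which would decrease the distance to [x]. *)
Lemma nearest_pt_proj X x : convex_body X -> is_proj X x (nearest_pt x X).
Proof.
move=> [X0 Xc Xconv].
have [y yX ymin] : exists2 c, c \in X &
    forall t, t \in X -> enorm (x - c) <= enorm (x - t).
  apply: compact_EVT_min => //; apply: continuous_subspaceT => t.
  apply: (@continuous_comp _ _ _ (fun y : 'cV[R]_d => x - y)).
    by apply: continuousB; [exact: cst_continuous|exact: cvg_id].
  exact: continuous_enorm.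
have [Xn nmin] : X (nearest_pt x X) /\
    forall z, X z -> enorm (x - nearest_pt x X) <= enorm (x - z).
  apply: (@xgetPex _ 0 [set y | X y /\ forall z, X z -> enorm (x - y) <= enorm (x - z)]).
  exists y; split; first by rewrite inE in yX.
  by move=> z Xz; apply: ymin; rewrite inE.
set n := nearest_pt x X in Xn nmin *; split=> // z Xz.
rewrite leNgt; apply/negP => pos.
have zz : 0 < dot (z - n) (z - n).
  rewrite dot_gt0; apply/eqP => zn0; move: pos; by rewrite zn0 dot0r ltxx.
(* the minimizer of the distance along the segment from [n] to [z] *)
pose t := Num.min 1 (dot (x - n) (z - n) / dot (z - n) (z - n)).
have t0 : 0 < t by rewrite lt_min ltr01 divr_gt0.
have t1 : t <= 1 by rewrite ge_min lexx.
have tz : t * dot (z - n) (z - n) <= dot (x - n) (z - n).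
  by rewrite -ler_pdivlMr // ge_min lexx orbT.
have := nmin _ (Xconv n z t Xn Xz _); rewrite t1 ltW // => /(_ isT).
rewrite le_enorm opprD addrA; move: pos tz t0 t1 {zz}; rewrite {}/t.
move: (x - n) (z - n) (Num.min _ _) => p q t pos tz t0 t1.
rewrite dotBl !dotBr !dotZl !dotZr (dotC q p).
by have := mulr_gt0 t0 pos; nra.
Qed.

Lemma nearest_pt_id X x : convex_body X -> X x -> nearest_pt x X = x.
Proof.
move=> Xb Xx; apply/eqP; rewrite eq_sym -subr_eq0 -dot_eq0.
have [_ /(_ x Xx) h] := nearest_pt_proj x Xb.
by rewrite eq_le dot_ge0 h.
Qed.

(** The slab orthogonal to [x - y] between [y] and [x] separates [x] from [Y], and
it separates [p] from [Y] as well. *)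
Lemma le_dist_direction Y x y p : convex_body Y -> is_proj Y x y ->
  dot (x - y) x <= dot (x - y) p -> dist x Y <= dist p Y.
Proof.
move=> Yb pxy h; rewrite (dist_proj pxy) (dist_proj (nearest_pt_proj p Yb)).
set m := nearest_pt p Y; have [Ym _] := nearest_pt_proj p Yb.
have [_ /(_ m Ym)] := pxy; rewrite dotBr => h2.
have := cauchy_schwarz (x - y) (p - m).
have := enorm_sqr (x - y); have := enorm_ge0 (x - y); have := enorm_ge0 (p - m).
rewrite [dot (x - y) (p - m)]dotBr [dot (x - y) (x - y)]dotBr => p0 u0 uu cs.
have [-> //|un0] := eqVneq (enorm (x - y)) 0.
have {}un0 : 0 < enorm (x - y) by rewrite lt_neqAle eq_sym un0.
rewrite -(ler_pM2l un0); apply: le_trans cs.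
by rewrite -expr2 uu; lra.
Qed.

Lemma normal_cone0 X x : normal_cone X x 0.
Proof. by move=> y _; rewrite dot0l. Qed.

(** The cone contains the origin, so its affine hull contains the line through [u]
in the direction [w]. *)
Lemma relint_normal_coneB X x u w :
  relint (normal_cone X x) u -> normal_cone X x w ->
  exists2 e : R, 0 < e & normal_cone X x (u - e *: w).
Proof.
move=> [Nu [e e0 eN]] Nw.
have [f f0 /(_ tt) fe] := @small_multiple R unit (fun=> enorm w) (fun=> e) (fun=> e0).
exists f => //; apply: eN; last first.
  by rewrite addrAC subrr add0r enormN enormZ gtr0_norm.
(* [u - f *: w] is an affine combination of [u], [w] and the apex 0 *)
pose v (i : 'I_3) : 'cV[R]_d := if val i == 0 then u else if val i == 1 then w else 0.
pose a (i : 'I_3) : R := if val i == 0 then 1 else if val i == 1 then - f else f.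
exists 3, a, v; split.
- move=> i; rewrite /v; do 2!case: ifP => // _; exact: normal_cone0.
- by rewrite !big_ord_recl big_ord0 /a /=; lra.
- by rewrite !big_ord_recl big_ord0 /a /v /= scaler0 !addr0 scale1r scaleNr.
Qed.

(** At an interior point the normal cone is reduced to the origin, so both
clauses of stability say that the displacement lies in the relative interior
of the normal cone. *)
Lemma stable_relint X x : convex_body X -> hausdorff_stable X x ->
  relint (normal_cone X (nearest_pt x X)) (x - nearest_pt x X).
Proof.
move=> Xb [Xx|[] //].
have Xx' := interior_subset Xx; rewrite (nearest_pt_id Xb Xx') subrr.
split; first exact: normal_cone0.
exists 1 => // y Ay _.
have N0 u : normal_cone X x u -> u = 0.
  move=> Nu; have [r r0 rX] := (interior_enormP X x).1 Xx.
  have [f f0 /(_ tt) fr] := @small_multiple R unit (fun=> enorm u) (fun=> r) (fun=> r0).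
  apply/eqP; rewrite -dot_eq0.
  have : dot u u <= 0.
    have := Nu (x + f *: u); rewrite addrAC subrr add0r dotZr pmulr_rle0 //; apply.
    by apply: rX; rewrite addrAC subrr add0r enormZ gtr0_norm.
  by move=> uu; rewrite eq_le uu dot_ge0.
have [m [a [v [Nv _ ->]]]] := Ay.
rewrite big1 => [|i _]; last by rewrite (N0 _ (Nv i)) scaler0.
exact: normal_cone0.
Qed.

(** The face exposed by [u] lies in every other face through [x]: the normal [w]
of such a face belongs to the normal cone, and moving from [u] away from [w]
without leaving the cone shows that [w] is maximal wherever [u] is. *)
Lemma smallest_faceE X x u : X x -> relint (normal_cone X x) u ->
  smallest_face X x = [set y | X y /\ dot u y = dot u x].
Proof.
move=> Xx ru; have Nu : normal_cone X x u by case: ru.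
apply/seteqP; split=> [y|y [Xy uy] F [[w ->] [_ wx]]].
  apply; split; last by split.
  exists u; apply/seteqP; split=> [z [Xz uz]|z [Xz uz]]; split=> //.
    by move=> t /Nu; rewrite dotBr subr_le0 uz.
  apply/le_anti; rewrite uz // andbT.
  by have := Nu z Xz; rewrite dotBr subr_le0.
have Nw : normal_cone X x w by move=> t Xt; rewrite dotBr subr_le0 wx.
have [e e0 /(_ y Xy)] := relint_normal_coneB ru Nw.
rewrite dotBl [dot u _]dotBr uy subrr sub0r oppr_le0 dotZl pmulr_rge0 // dotBr subr_ge0.
by move=> xy; split=> // t Xt; exact: le_trans (wx t Xt) xy.
Qed.

End ConvexSets.

(** * Polytopes and Farkas' lemma *)

Section Polytopes.
Variables (R : realType) (d : nat).
Implicit Types (x y u w : 'cV[R]_d).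

Definition hull m (v : 'I_m -> 'cV[R]_d) : set 'cV[R]_d :=
  [set y | exists a : 'I_m -> R,
     [/\ forall i, 0 <= a i, \sum_i a i = 1 & y = \sum_i a i *: v i]].

Lemma sum_delta m (i : 'I_m) : \sum_j (j == i)%:R = 1 :> R.
Proof. by rewrite (bigD1 i) //= eqxx big1 ?addr0 // => j /negbTE ->. Qed.

Lemma sum_deltaZ m (v : 'I_m -> 'cV[R]_d) i : \sum_j (j == i)%:R *: v j = v i.
Proof.
rewrite (bigD1 i) //= eqxx scale1r big1 ?addr0 // => j /negbTE ->.
by rewrite scale0r.
Qed.

Lemma hull_gen m (v : 'I_m -> 'cV[R]_d) i : hull v (v i).
Proof.
exists (fun j => (j == i)%:R); split=> [j||]; first exact: ler0n.
  exact: sum_delta.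
by rewrite sum_deltaZ.
Qed.

Lemma convex_body_hull m (v : 'I_m.+1 -> 'cV[R]_d) : convex_body (hull v).
Proof.
split; first by exists (v ord0); exact: hull_gen.
- pose S : set 'cV[R]_m.+1 := @cube R m.+1 `&` [set a | \sum_i a i 0 = 1].
  have -> : hull v = (fun a : 'cV[R]_m.+1 => \sum_i a i 0 *: v i) @` S.
    apply/seteqP; split=> [_ [a [a0 a1 ->]]|_ [a [ac a1] <-]].
      exists (\col_i a i); last by apply: eq_bigr => i _; rewrite mxE.
      split=> /= [i|]; last by under eq_bigr do rewrite mxE.
      by rewrite mxE a0 -a1 (bigD1 i) //= lerDl sumr_ge0.
    by exists (fun i => a i 0); split=> // i; have /andP[] := ac i.
  apply: continuous_compact.
    apply: continuous_subspaceT => a; apply: continuous_mx => k l.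
    under [X in {for _, continuous X}]eq_fun do rewrite summxE.
    apply: continuous_sumr => i.
    under [X in {for _, continuous X}]eq_fun do rewrite mxE.
    by apply: continuousM; [exact: coord_continuous|exact: cst_continuous].
  apply: compact_closedI; first exact: compact_cube.
  apply: (@closed_comp _ _ (fun a : 'cV[R]_m.+1 => \sum_i a i 0) [set 1]).
    by move=> a _; apply: continuous_sumr => i; exact: coord_continuous.
  exact: closed_eq.
- move=> _ _ t [a [a0 a1 ->]] [b [b0 b1 ->]] /andP[t0 t1].
  exists (fun i => a i + t * (b i - a i)); split.
  + by move=> i; have := a0 i; have := b0 i; nra.
  + by rewrite big_split /= -mulr_sumr sumrB a1 b1 subrr mulr0 addr0.
  + rewrite -sumrB scaler_sumr -big_split; apply: eq_bigr => i _ /=.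
    by rewrite scalerDl -scalerA scalerBl.
Qed.

Lemma hull_le_dot m (v : 'I_m -> 'cV[R]_d) u c :
  (forall i, dot u (v i) <= c) -> forall x, hull v x -> dot u x <= c.
Proof.
move=> uv _ [a [a0 a1 ->]]; rewrite dot_sumr -[c]mul1r -a1 mulr_suml.
by apply: ler_sum => i _; rewrite dotZr ler_wpM2l.
Qed.

(** Among the generators that maximize [w], take the one that is farthest from
the origin: adding a small multiple of it to [w] breaks the ties. *)
Lemma vertex_maximizing m (v : 'I_m.+1 -> 'cV[R]_d) w x :
  hull v x -> exists2 p, Vert (hull v) p & dot w x <= dot w p.
Proof.
move=> vx; pose k0 := [arg max_(i > ord0) dot w (v i)]%O.
have k0max i : dot w (v i) <= dot w (v k0).
  by rewrite /k0; case: Order.TotalTheory.arg_maxP => // j _; apply.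
pose k := [arg max_(i > k0 | dot w (v i) == dot w (v k0)) dot (v i) (v i)]%O.
have [wk kmax] : dot w (v k) = dot w (v k0) /\
    forall i, dot w (v i) = dot w (v k0) -> dot (v i) (v i) <= dot (v k) (v k).
  rewrite /k; case: Order.TotalTheory.arg_maxP => // j /eqP wj jmax.
  by split=> // i /eqP; exact: jmax.
(* the gaps that the perturbation must not close; ties are unconstrained *)
pose c i := if dot w (v i) == dot w (v k) then 1 else dot w (v k) - dot w (v i).
have c0 i : 0 < c i.
  rewrite /c; case: ifPn => // ne; rewrite subr_gt0 lt_neqAle ne /=.
  by rewrite wk k0max.
have [e e0 ec] := small_multiple (fun i => dot (v k) (v i) - dot (v k) (v k)) c0.
have strict i : v i != v k -> dot (w + e *: v k) (v i) < dot (w + e *: v k) (v k).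
  move=> vik; rewrite !dotDl !dotZl; have := ec i; rewrite /c.
  case: ifPn => [/eqP wi _|_]; last by lra.
  rewrite wi ltrD2l ltr_pM2l //.
  have : 0 < dot (v i - v k) (v i - v k) by rewrite dot_gt0 subr_eq0.
  rewrite !dotBl !dotBr (dotC (v i) (v k)).
  by have := kmax i (etrans wi wk); lra.
exists (v k); last by rewrite wk; apply: (hull_le_dot k0max).
exists (w + e *: v k); apply/seteqP; split=> [_ ->|y [vy ymax]].
  split; first exact: hull_gen.
  move=> y; apply: hull_le_dot => i; have [->//|/strict/ltW//] := eqVneq (v i) (v k).
have {ymax} := ymax _ (hull_gen v k); have [a [a0 a1 ->]] := vy.
set u := w + _ => h; have hsum : \sum_i a i * (dot u (v k) - dot u (v i)) <= 0.
  under eq_bigr do rewrite mulrBr.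
  rewrite sumrB -mulr_suml a1 mul1r subr_le0 (le_trans h) // dot_sumr.
  by apply: ler_sum => i _; rewrite dotZr.
have term0 i : 0 <= a i * (dot u (v k) - dot u (v i)).
  rewrite mulr_ge0 // subr_ge0.
  by have [->//|/strict/ltW//] := eqVneq (v i) (v k).
have {}hsum : \sum_i a i * (dot u (v k) - dot u (v i)) == 0.
  by rewrite eq_le hsum sumr_ge0.
rewrite psumr_eq0 // in hsum; move/allP: hsum => hsum.
rewrite /=; transitivity (\sum_i a i *: v k).
  2: by rewrite -scaler_suml a1 scale1r.
apply: eq_bigr => i _; have [->//|/[dup] vik /strict uik] := eqVneq (v i) (v k).
have := hsum i (mem_index_enum i); rewrite mulf_eq0 subr_eq0 (gt_eqF uik) orbF.
by move=> /eqP ->; rewrite !scale0r.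
Qed.

Lemma Vert_hull m (v : 'I_m -> 'cV[R]_d) p :
  Vert (hull v) p -> exists i, p = v i.
Proof.
move=> [u fp].
have [[a [a0 a1 pa]] pmax] : [set x | hull v x /\
  forall y, hull v y -> dot u y <= dot u x] p by rewrite -fp.
have [i ai] : exists i, a i != 0.
  apply/existsP; rewrite -negb_forall; apply/negP => /forallP z.
  move: a1; rewrite big1 => [/eqP|i _]; last exact/eqP.
  by rewrite eq_sym oner_eq0.
have ai0 : 0 < a i by rewrite lt_neqAle eq_sym ai a0.
exists i; symmetry; have -> // : [set p] (v i).
rewrite fp; split; first exact: hull_gen.
move=> y vy; apply: le_trans (pmax y vy) _.
rewrite -(ler_pM2l ai0) -subr_ge0 -mulrBr -dotBr.
have : \sum_j a j * dot u (p - v j) = 0.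
  under eq_bigr do rewrite dotBr mulrBr.
  rewrite sumrB -mulr_suml a1 mul1r {1}pa dot_sumr.
  by under [X in _ - X]eq_bigr do rewrite -dotZr; rewrite subrr.
rewrite (bigD1 i) //= => /eqP; rewrite addr_eq0 => /eqP h.
have : 0 <= \sum_(j < m | j != i) a j * dot u (p - v j).
  apply: sumr_ge0 => j _; rewrite mulr_ge0 // dotBr subr_ge0 pmax //.
  exact: hull_gen.
by rewrite -(opprB p) dotNr mulrN h opprK.
Qed.

(** Bartl's induction: if the last constraint is not redundant, some [x]
satisfies the others and violates the conclusion; projecting along [x] onto
the hyperplane orthogonal to the last vector removes that constraint. *)
Lemma farkas m (a : 'I_m -> 'cV[R]_d) b :
  (forall x, (forall i, dot (a i) x <= 0) -> dot b x <= 0) ->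
  exists2 l : 'I_m -> R, (forall i, 0 <= l i) & b = \sum_i l i *: a i.
Proof.
elim: m a b => [|m IH] a b h.
  exists (fun=> 0) => //; rewrite big_ord0; apply/eqP; rewrite -dot_eq0 eq_le.
  by rewrite dot_ge0 h // => -[].
pose a' i := a (widen_ord (leqnSn m) i).
have [red|] := pselect (forall x, (forall i, dot (a' i) x <= 0) -> dot b x <= 0).
  have [l l0 bl] := IH a' b red.
  exists (fun i => oapp l 0 (unlift ord_max i)).
    by move=> i; case: unlift => //=.
  rewrite big_ord_recr /= unlift_none scale0r addr0 bl; apply: eq_bigr => i _.
  have -> : widen_ord (leqnSn m) i = lift ord_max i.
    by apply/val_inj; rewrite /= /bump leqNgt ltn_ord.
  by rewrite liftK /= /a'; congr (_ *: a _); apply/val_inj; rewrite /= /bump leqNgt ltn_ord.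
move=> /existsNP[x /not_implyP[ax /negP]]; rewrite -ltNge => bx.
set c := a ord_max.
have cx : 0 < dot c x.
  rewrite ltNge; apply/negP => cx; move: bx; rewrite ltNge h // => i.
  have [j ->|->//] := unliftP ord_max i.
  by have := ax j; rewrite /a' (_ : widen_ord _ j = lift ord_max j) //;
     apply/val_inj; rewrite /= /bump leqNgt ltn_ord.
pose pr y := y - (dot y x / dot c x) *: c.
have prE y z : dot (pr y) z = dot y (z - (dot c z / dot c x) *: x).
  by rewrite /pr dotBl dotZl dotBr dotZr; field; rewrite gt_eqF.
have [y ay|l l0 bl] := IH (fun i => pr (a' i)) (pr b).
  rewrite prE; apply: h => i.
  have [j ->|->] := unliftP ord_max i.
    have := ay j; rewrite prE /a' (_ : widen_ord _ j = lift ord_max j) //.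
    by apply/val_inj; rewrite /= /bump leqNgt ltn_ord.
  by rewrite dotBr dotZr divfK ?gt_eqF // subrr.
(* the weight of the last vector, nonnegative because [x] violates the
   conclusion while satisfying the other constraints *)
pose lm := (dot b x - \sum_i l i * dot (a' i) x) / dot c x.
have lm0 : 0 <= lm.
  rewrite divr_ge0 ?(ltW cx) // subr_ge0 (le_trans _ (ltW bx)) //.
  by rewrite sumr_le0 // => i _; rewrite mulr_ge0_le0.
exists (fun i => oapp l lm (unlift ord_max i)).
  by move=> i; case: unlift => //=.
rewrite big_ord_recr /= unlift_none /=.
have -> : \sum_(i < m) oapp l lm (unlift ord_max (widen_ord (leqnSn m) i)) *:
    a (widen_ord (leqnSn m) i) = \sum_(i < m) l i *: a' i.
  apply: eq_bigr => i _.
  rewrite [X in unlift _ X](_ : _ = lift ord_max i) ?liftK //.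
  by apply/val_inj; rewrite /= /bump leqNgt ltn_ord.
have -> : b = pr b + (dot b x / dot c x) *: c by rewrite subrK.
rewrite bl -/c.
under eq_bigr do rewrite /pr scalerBr scalerA.
rewrite sumrB -addrA; congr (_ + _); rewrite -scaler_suml addrC -scalerBl.
congr (_ *: _); rewrite /lm mulrBl; congr (_ - _).
by rewrite mulr_suml; apply: eq_bigr => i _; rewrite mulrA.
Qed.

(** If [u] lies in the relative interior of the normal cone at [x], no
supporting hyperplane at [x] can separate [x] strictly from a generator [v j]
of the exposed face; by Farkas' lemma the face extends from [v j] beyond [x],
so that [x] has a representation in which [v j] occurs. *)
Lemma relint_positive_weights m (v : 'I_m -> 'cV[R]_d) x u :
  hull v x -> relint (normal_cone (hull v) x) u ->
  exists a : 'I_m -> R,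
    [/\ forall i, 0 <= a i, \sum_i a i = 1, x = \sum_i a i *: v i
      & forall i, 0 < a i <-> dot u (v i) = dot u x].
Proof.
move=> vx ru; have Nu : normal_cone (hull v) x u by case: ru.
have uv i : dot u (v i) <= dot u x.
  by have := Nu _ (hull_gen v i); rewrite dotBr subr_le0.
pose rep (a : 'I_m -> R) :=
  [/\ forall i, 0 <= a i, \sum_i a i = 1 & x = \sum_i a i *: v i].
have repj j : exists a, rep a /\ (dot u (v j) = dot u x -> 0 < a j).
  have [uj|] := eqVneq (dot u (v j)) (dot u x); last first.
    by move=> /eqP ne; have [a ra] := vx; exists a; split.
  have [|l l0 bl] := @farkas m (fun i => v i - x) (x - v j).
    move=> w wx; have Nw : normal_cone (hull v) x w.
      move=> y vy; rewrite dotBr subr_le0; apply: hull_le_dot vy => i.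
      by have := wx i; rewrite dotC dotBr subr_le0.
    have [e e0 /(_ _ (hull_gen v j)) uwj] := relint_normal_coneB ru Nw.
    have : 0 <= dot w (v j - x).
      by move: uwj; rewrite dotBl dotZl (dotBr u) uj subrr sub0r oppr_le0 pmulr_rge0.
    by rewrite (dotC _ w) !dotBr; lra.
  pose s := 1 + \sum_i l i.
  have s0 : 0 < s by rewrite ltr_pwDl // sumr_ge0.
  exists (fun i => ((i == j)%:R + l i) / s); split; last first.
    by move=> _; rewrite eqxx divr_gt0 // ltr_pwDl.
  split.
  - by move=> i; rewrite divr_ge0 ?(ltW s0) // addr_ge0.
  - by rewrite -mulr_suml big_split /= sum_delta divff ?gt_eqF.
  - apply: (scalerI (lt0r_neq0 s0)); rewrite scaler_sumr.
    have ss : s * s^-1 = 1 by rewrite divff ?gt_eqF.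
    under eq_bigr do rewrite scalerA mulrCA ss mulr1 scalerDl.
    rewrite big_split /= sum_deltaZ /s scalerDl scale1r.
    have {}bl : x - v j = \sum_i l i *: v i - (\sum_i l i) *: x.
      by rewrite bl scaler_suml -sumrB; apply: eq_bigr => i _; rewrite scalerBr.
    by rewrite -[X in X + _ = _](subrK (v j)) bl addrAC subrK addrC.
have [A HA] := choice repj.
have rep_zero a i : rep a -> dot u (v i) != dot u x -> a i = 0.
  move=> [a0 a1 xa] ui.
  have : \sum_j a j * (dot u x - dot u (v j)) == 0.
    under eq_bigr do rewrite mulrBr -!dotZr.
    by rewrite sumrB -!dot_sumr -xa -scaler_suml a1 scale1r subrr.
  rewrite psumr_eq0 => [/allP /(_ i (mem_index_enum i))|j _].
    by rewrite mulf_eq0 subr_eq0 [_ == dot u (v i)]eq_sym (negbTE ui) orbF => /eqP.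
  by rewrite mulr_ge0 // subr_ge0.
have m0 : 0 < m%:R :> R.
  rewrite ltr0n lt0n; apply/eqP => m0; have [a [_ a1 _]] := vx.
  move: a1; rewrite big1 => [/eqP|i _]; first by rewrite eq_sym oner_eq0.
  by exfalso; case: i; rewrite m0.
(* the average of representations in which each [v j] of the face occurs *)
exists (fun i => (\sum_j A j i) / m%:R); split.
- by move=> i; rewrite divr_ge0 ?ler0n // sumr_ge0 // => j _; have [[]] := HA j.
- rewrite -mulr_suml exchange_big /=.
  under eq_bigr => j _ do (have [[_ -> _] _] := HA j).
  by rewrite sumr_const card_ord divff ?gt_eqF.
- apply: (scalerI (lt0r_neq0 m0)); rewrite scaler_sumr.
  have mm : m%:R * m%:R^-1 = 1 :> R by rewrite divff ?gt_eqF.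
  under eq_bigr do rewrite scalerA mulrCA mm mulr1 scaler_suml.
  rewrite exchange_big /=.
  under eq_bigr => j _ do (have [[_ _ <-] _] := HA j).
  by rewrite sumr_const card_ord scaler_nat.
- move=> i; split=> [ai|ui].
    apply/eqP; apply: contraTT ai => ui; rewrite big1 ?mul0r ?ltxx // => j _.
    by apply: rep_zero ui; have [] := HA j.
  rewrite divr_gt0 // (bigD1 i) //= ltr_pwDl //; first by have [_ ->] := HA i.
  by rewrite sumr_ge0 // => j _; have [[]] := HA j.
Qed.

End Polytopes.

(** * Rational functions of the parameters *)

Section RationalFunctions.
Variables (R : realType) (d n : nat).
Local Notation T := ('M[R]_(d, n) * 'cV[R]_d)%type.
Implicit Types (f g : T -> R).

(** Polynomial functions given by their construction, so that continuity,
differentiability and representability by a multivariate polynomial are each one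
induction. *)
Inductive polyfun : (T -> R) -> Prop :=
| polyfun_cst c : polyfun (fun=> c)
| polyfun_gen i j : polyfun (fun Z => Z.1 i j)
| polyfun_shift i : polyfun (fun Z => Z.2 i 0)
| polyfunD f g : polyfun f -> polyfun g -> polyfun (fun Z => f Z + g Z)
| polyfunM f g : polyfun f -> polyfun g -> polyfun (fun Z => f Z * g Z).

Lemma polyfun_differentiable f Z : polyfun f -> differentiable f Z.
Proof.
elim=> {f} [c|i j|i|f g _ fd _ gd|f g _ fd _ gd].
- exact: differentiable_cst.
- apply: (@differentiable_comp _ _ _ _ fst (fun A : 'M[R]_(d, n) => A i j)).
    by apply: linear_differentiable => Y; exact: cvg_fst.
  exact: differentiable_coord.
- apply: (@differentiable_comp _ _ _ _ snd (fun A : 'cV[R]_d => A i 0)).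
    by apply: linear_differentiable => Y; exact: cvg_snd.
  exact: differentiable_coord.
- exact: differentiableD.
- exact: differentiableM.
Qed.

Lemma polyfun_continuous f : polyfun f -> continuous f.
Proof. by move=> pf Z; apply/differentiable_continuous/polyfun_differentiable. Qed.

Lemma polyfun_mpoly f : polyfun f ->
  exists N : mpoly.mpoly (d * n + d) R, forall Q mu,
    f (Q, mu) = mpoly.meval (fun i => params Q mu 0 i) N.
Proof.
elim=> {f} [c|i j|i|f g _ [N fN] _ [M gM]|f g _ [N fN] _ [M gM]].
- exists (mpoly.mpolyC _ c) => Q mu; by rewrite mpoly.mevalC.
- exists (mpoly.mpolyX R (mpoly.mnm1 (lshift d (mxvec_index i j)))) => Q mu /=.
  by rewrite mpoly.mevalXU row_mxEl mxvecE.
- exists (mpoly.mpolyX R (mpoly.mnm1 (rshift (d * n) i))) => Q mu /=.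
  by rewrite mpoly.mevalXU row_mxEr mxE.
- exists (N + M) => Q mu; by rewrite mpoly.mevalD fN gM.
- exists (N * M) => Q mu; by rewrite mpoly.mevalM fN gM.
Qed.

Variable Z0 : T.

(** The quotient need only agree with [f] near [Z0]: the inverse matrix is given
by the adjugate formula only where the determinant does not vanish. *)
Definition rational_near f := exists N D,
  [/\ polyfun N, polyfun D, D Z0 != 0 & \forall Z \near Z0, f Z = N Z / D Z].

Lemma near_neq0 f : {for Z0, continuous f} -> f Z0 != 0 ->
  \forall Z \near Z0, f Z != 0.
Proof.
move=> fc f0.
have : \forall Z \near Z0, 0 < `|f Z|.
  apply: (@near_lt _ _ (fun=> 0) (fun Z => `|f Z|)); first exact: cst_continuous.
    by apply: (@continuous_comp _ _ _ f); [exact: fc|exact: norm_continuous].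
  by rewrite normr_gt0.
by apply: filterS => Z; rewrite normr_gt0.
Qed.

Lemma polyfun_rational f : polyfun f -> rational_near f.
Proof.
move=> pf; exists f, (fun=> 1); split=> //.
- exact: polyfun_cst.
by near=> Z; rewrite divr1.
Unshelve. all: by end_near. Qed.

Lemma rational_cst c : rational_near (fun=> c).
Proof. exact/polyfun_rational/polyfun_cst. Qed.

Lemma rationalD f g : rational_near f -> rational_near g ->
  rational_near (fun Z => f Z + g Z).
Proof.
move=> [N [D [pN pD D0 fE]]] [N' [D' [pN' pD' D0' gE]]].
exists (fun Z => N Z * D' Z + N' Z * D Z), (fun Z => D Z * D' Z); split.
- by apply: polyfunD; apply: polyfunM.
- exact: polyfunM.
- by rewrite mulf_neq0.
- have cD : {for Z0, continuous D} by exact: polyfun_continuous.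
  have cD' : {for Z0, continuous D'} by exact: polyfun_continuous.
  near=> Z; have -> : f Z = N Z / D Z by near: Z.
  have -> : g Z = N' Z / D' Z by near: Z.
  rewrite addf_div //; first by near: Z; exact: near_neq0.
  by near: Z; exact: near_neq0.
Unshelve. all: by end_near. Qed.

Lemma rationalM f g : rational_near f -> rational_near g ->
  rational_near (fun Z => f Z * g Z).
Proof.
move=> [N [D [pN pD D0 fE]]] [N' [D' [pN' pD' D0' gE]]].
exists (fun Z => N Z * N' Z), (fun Z => D Z * D' Z); split.
- exact: polyfunM.
- exact: polyfunM.
- by rewrite mulf_neq0.
- by near=> Z; rewrite -mulf_div; congr (_ * _); near: Z.
Unshelve. all: by end_near. Qed.

Lemma rationalV f : rational_near f -> f Z0 != 0 ->
  rational_near (fun Z => (f Z)^-1).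
Proof.
move=> [N [D [pN pD D0 fE]]] f0; exists D, N; split=> //.
  by move: f0; rewrite (nbhs_singleton fE); apply: contraNneq => ->; rewrite mul0r.
by apply: filterS fE => Z ->; rewrite invf_div.
Qed.

Lemma rational_sum (I : Type) (r : seq I) (Pr : pred I) (F : I -> T -> R) :
  (forall i, rational_near (F i)) ->
  rational_near (fun Z => \sum_(i <- r | Pr i) F i Z).
Proof.
move=> rF; elim: r => [|i r IH].
  under [X in rational_near X]eq_fun do rewrite big_nil; exact: rational_cst.
under [X in rational_near X]eq_fun do rewrite big_cons.
by case: (Pr i) => //; apply: rationalD.
Qed.

Lemma rational_prod (I : Type) (r : seq I) (Pr : pred I) (F : I -> T -> R) :
  (forall i, rational_near (F i)) ->
  rational_near (fun Z => \prod_(i <- r | Pr i) F i Z).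
Proof.
move=> rF; elim: r => [|i r IH].
  under [X in rational_near X]eq_fun do rewrite big_nil; exact: rational_cst.
under [X in rational_near X]eq_fun do rewrite big_cons.
by case: (Pr i) => //; apply: rationalM.
Qed.

Lemma rational_continuous f : rational_near f -> {for Z0, continuous f}.
Proof.
move=> [N [D [pN pD D0 fE]]].
have fE' : \forall Z \near Z0, N Z / D Z = f Z.
  by apply: filterS fE => Z ->.
have h : {for Z0, continuous (fun Z => N Z / D Z)}.
  apply: continuousM; first exact: polyfun_continuous.
  by apply: continuousV => //; exact: polyfun_continuous.
rewrite /prop_for /continuous_at (nbhs_singleton fE).
apply: cvg_trans h; exact: near_eq_cvg.
Qed.

Definition rational_mx m k (F : T -> 'M[R]_(m, k)) :=
  forall i j, rational_near (fun Z => F Z i j).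

Lemma rational_mx_cst m k (A : 'M[R]_(m, k)) : rational_mx (fun=> A).
Proof. by move=> i j; exact: rational_cst. Qed.

Lemma rational_mx_gen : rational_mx (fun Z => Z.1).
Proof. by move=> i j; exact/polyfun_rational/polyfun_gen. Qed.

Lemma rational_mx_shift : rational_mx (fun Z => Z.2).
Proof. by move=> i j; rewrite ord1; exact/polyfun_rational/polyfun_shift. Qed.

Lemma rational_mxD m k (F G : T -> 'M[R]_(m, k)) :
  rational_mx F -> rational_mx G -> rational_mx (fun Z => F Z + G Z).
Proof.
move=> rF rG i j; under [X in rational_near X]eq_fun do rewrite mxE.
exact: rationalD.
Qed.

Lemma rational_mxN m k (F : T -> 'M[R]_(m, k)) :
  rational_mx F -> rational_mx (fun Z => - F Z).
Proof.
move=> rF i j; under [X in rational_near X]eq_fun do rewrite mxE -mulN1r.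
by apply: rationalM => //; exact: rational_cst.
Qed.

Lemma rational_mxB m k (F G : T -> 'M[R]_(m, k)) :
  rational_mx F -> rational_mx G -> rational_mx (fun Z => F Z - G Z).
Proof. by move=> rF rG; apply: rational_mxD => //; exact: rational_mxN. Qed.

Lemma rational_mxM m k p (F : T -> 'M[R]_(m, k)) (G : T -> 'M[R]_(k, p)) :
  rational_mx F -> rational_mx G -> rational_mx (fun Z => F Z *m G Z).
Proof.
move=> rF rG i j; under [X in rational_near X]eq_fun do rewrite mxE.
by apply: rational_sum => l; exact: rationalM.
Qed.

Lemma rational_trmx m k (F : T -> 'M[R]_(m, k)) :
  rational_mx F -> rational_mx (fun Z => (F Z)^T).
Proof. by move=> rF i j; under [X in rational_near X]eq_fun do rewrite mxE. Qed.

Lemma rational_det m (F : T -> 'M[R]_m) :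
  rational_mx F -> rational_near (fun Z => \det (F Z)).
Proof.
move=> rF; apply: rational_sum => s; apply: rationalM; first exact: rational_cst.
by apply: rational_prod => i; exact: rF.
Qed.

(** Cramer's rule. *)
Lemma rational_invmx m (F : T -> 'M[R]_m) :
  rational_mx F -> F Z0 \in unitmx -> rational_mx (fun Z => invmx (F Z)).
Proof.
move=> rF; rewrite unitmxE unitfE => u0.
have rdet := rational_det rF.
have radj : rational_mx (fun Z => \adj (F Z)).
  move=> i j; under [X in rational_near X]eq_fun do rewrite mxE /cofactor.
  apply: rationalM; first exact: rational_cst.
  apply: rational_det => a b.
  by under [X in rational_near X]eq_fun do rewrite !mxE.
move=> i j.
have [N [D [pN pD D0 E]]] : rational_near (fun Z => (\det (F Z))^-1 * (\adj (F Z)) i j).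
  by apply: rationalM => //; exact: rationalV.
exists N, D; split=> //.
have := near_neq0 (rational_continuous rdet) u0.
by apply: filterS2 E => Z E u; rewrite -E /invmx unitmxE unitfE u mxE.
Qed.

Lemma rational_dot m (F G : T -> 'cV[R]_m) :
  rational_mx F -> rational_mx G -> rational_near (fun Z => dot (F Z) (G Z)).
Proof.
move=> rF rG; under [X in rational_near X]eq_fun do rewrite dotE.
by apply: rational_sum => l; exact: rationalM.
Qed.

End RationalFunctions.

Section SquareRoots.
Variables (R : realType) (d n : nat).
Local Notation T := ('M[R]_(d, n) * 'cV[R]_d)%type.

Definition sqrt_rational_term (U : set T) (t : 'M[R]_(d, n) -> 'cV[R]_d -> R)
    (reg : Prop) :=
  sqrt_bounded_rational U t /\
  (reg -> forall Z, U Z -> differentiable (fun Z : T => t Z.1 Z.2) Z).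

(** The differential of [g] satisfies the defining estimate for [f], because that
estimate is local. *)
Lemma near_eq_differentiable (f g : T -> R) Z :
  (\forall Y \near Z, g Y = f Y) -> differentiable g Z -> differentiable f Z.
Proof.
move=> fg dg.
have fgZ : g Z = f Z by exact: nbhs_singleton fg.
have fE : f \o shift Z = cst (f Z) + 'd g Z +o_ (0 : T) id.
  have /eqaddoP h := diff_locally dg.
  have sh : (fun k : T => k + Z) @ (0 : T) --> Z.
    rewrite -[X in _ --> X]add0r; apply: cvgD; [exact: cvg_id|exact: cvg_cst].
  have fg0 : \forall k \near (0 : T), g (k + Z) = f (k + Z) by exact: sh _ fg.
  apply/eqaddoP => e e0; near=> k.
  have -> : (f \o shift Z - (cst (f Z) + 'd g Z)) k =
            (g \o shift Z - (cst (g Z) + 'd g Z)) k.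
    rewrite !fctE /= fgZ; congr (_ - _); apply/esym.
    by near: k.
  by near: k; exact: h.
have dfE : 'd f Z = 'd g Z :> (T -> R) by apply: diff_unique => //; exact: diff_continuous.
by apply/diff_locallyP; rewrite dfE; split=> //; exact: diff_continuous.
Unshelve. all: by end_near. Qed.

Lemma differentiable_sqrt (x : R) : 0 < x -> differentiable (@Num.sqrt R) x.
Proof. by move=> x0; apply/derivable1_diffP; have [] := is_derive1_sqrt x0. Qed.

(** The bound is continuity at [Z0].  The square root is differentiable where its
argument is positive, and trivially where the argument is locally 0. *)
Lemma sqrt_rational_near (Z0 : T) (g : T -> R) (t : 'M[R]_(d, n) -> 'cV[R]_d -> R)
    (reg : Prop) :
  rational_near Z0 g -> (forall Z, 0 <= g Z) ->
  (\forall Z \near Z0, t Z.1 Z.2 = Num.sqrt (g Z)) ->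
  (reg -> 0 < g Z0 \/ \forall Z \near Z0, g Z = 0) ->
  exists2 U, nbhs Z0 U & sqrt_rational_term U t reg.
Proof.
move=> rg g0 tE treg; have [N [D [pN pD D0 gE]]] := rg.
have [pNm NE] := polyfun_mpoly pN; have [pDm DE] := polyfun_mpoly pD.
have Dc : {for Z0, continuous D} by exact: polyfun_continuous.
have gc := rational_continuous rg.
have gM : \forall Z \near Z0, g Z < g Z0 + 1.
  by apply: near_lt => //; [exact: cst_continuous|rewrite ltrDl].
pose good : set T := [set Z | [/\ D Z != 0, g Z = N Z / D Z, g Z < g Z0 + 1
  & t Z.1 Z.2 = Num.sqrt (g Z)]].
have good_near : nbhs Z0 good.
  near=> Z; split; near: Z => //; exact: near_neq0.
have sbr (U : set T) : U `<=` good -> sqrt_bounded_rational U t.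
  move=> Ugood; exists pNm, pDm, (g Z0 + 1) => Q mu /Ugood[DZ gZ gZM tZ] /=.
  by rewrite -NE -DE -gZ g0 (ltW gZM) DZ; split.
have [rT|nreg] := pselect reg; last first.
  by exists good => //; split; [exact: sbr|].
have [gpos|gz] := treg rT.
  have gp : \forall Z \near Z0, 0 < g Z.
    by apply: near_lt => //; exact: cst_continuous.
  pose V := (good `&` [set Z | 0 < g Z])°.
  have Vgood : V `<=` good `&` [set Z | 0 < g Z] by exact: interior_subset.
  have Vo : open V by exact: open_interior.
  have VZ0 : V Z0.
    by apply: filterI.
  exists V; first by apply: open_nbhs_nbhs.
  split; first by apply: sbr => Z /Vgood[].
  move=> _ Z VZ; have [[DZ gZ _ _] gZ0] := Vgood Z VZ.
  apply: (@near_eq_differentiable _ (fun Y => Num.sqrt (N Y / D Y))).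
    apply: filterS (open_nbhs_nbhs (conj Vo VZ)) => Y /Vgood[[_ gY _ ->] _].
    by rewrite gY.
  apply: (@differentiable_comp _ _ _ _ (fun Y => N Y / D Y) (@Num.sqrt R)).
    apply: differentiableM; first exact: polyfun_differentiable.
    by apply: differentiableV => //; exact: polyfun_differentiable.
  by apply: differentiable_sqrt; rewrite -gZ.
pose V := (good `&` [set Z | g Z = 0])°.
have Vgood : V `<=` good `&` [set Z | g Z = 0] by exact: interior_subset.
have Vo : open V by exact: open_interior.
have VZ0 : V Z0.
  by apply: filterI.
exists V; first by apply: open_nbhs_nbhs.
split; first by apply: sbr => Z /Vgood[].
move=> _ Z VZ.
apply: (@near_eq_differentiable _ (fun=> 0)); last exact: differentiable_cst.
apply: filterS (open_nbhs_nbhs (conj Vo VZ)) => Y /Vgood[[_ _ _ ->] /= ->].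
by rewrite sqrtr0.
Unshelve. all: by end_near. Qed.

End SquareRoots.

(** * Support functions *)

Section SupportFunctions.
Variables (R : realType) (d : nat).
Implicit Types (q y u : 'cV[R]_d) (X : set 'cV[R]_d).

(** A point [y] outside of [X] is separated from [X] by its displacement from the
nearest point, in a direction where [X] reaches [r] beyond [q]. *)
Lemma ball_sub_of_support X q r : convex_body X ->
  (forall u, exists2 z, X z & dot u q + r * enorm u <= dot u z) ->
  forall y, enorm (y - q) < r -> X y.
Proof.
move=> Xb sup_r y yr; have [Xm my] := nearest_pt_proj y Xb.
set m := nearest_pt y X in Xm my *.
have [ym|ym] := eqVneq (y - m) 0; first by rewrite -[y](subrK m) ym add0r.
have [z Xz] := sup_r (y - m); have := my z Xz.
have := cauchy_schwarz (y - m) (y - q); have : 0 < enorm (y - m) by rewrite enorm_gt0.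
have : 0 < dot (y - m) (y - m) by rewrite dot_gt0.
have yE : dot (y - m) (y - m) = dot (y - m) y - dot (y - m) m by rewrite -dotBr.
rewrite yE (dotBr _ z) (dotBr _ y q); move: (enorm (y - m)) => e.
by move=> um e0 cs zm; nra.
Qed.

Lemma support_of_interior X q : X° q ->
  exists2 r : R, 0 < r & forall u, exists2 z, X z & dot u q + r * enorm u <= dot u z.
Proof.
move=> /interior_enormP[r r0 rX]; exists (r / 2); first by rewrite divr_gt0.
move=> u; have [->|u0] := eqVneq u 0.
  exists q; first by apply: rX; rewrite subrr enorm0.
  by rewrite !dot0l enorm0 mulr0 addr0.
have un0 : 0 < enorm u by rewrite enorm_gt0.
exists (q + (r / 2 / enorm u) *: u).
  apply: rX; rewrite addrAC subrr add0r enormZ ger0_norm ?divfK ?gt_eqF //; first by lra.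
  by rewrite !divr_ge0 // ltW.
by rewrite dotDr dotZr -enorm_sqr expr2 mulrA divfK ?gt_eqF.
Qed.

Lemma compact_sphere : compact [set u : 'cV[R]_d | enorm u = 1].
Proof.
(* maps the cube onto a box that contains the sphere *)
pose f (x : 'cV[R]_d) : 'cV[R]_d := 2 *: x - const_mx 1.
apply: (@subclosed_compact _ _ (f @` @cube R d)).
- apply: (@closed_comp _ _ (@enorm R d) [set 1]); last exact: closed_eq.
  by move=> u _; exact: continuous_enorm.
- apply: continuous_compact; last exact: compact_cube.
  apply: continuous_subspaceT => x; apply: continuousB; last exact: cst_continuous.
  by apply: continuousZr; exact: cvg_id.
- move=> u u1; exists (2^-1 *: (u + const_mx 1)).
    move=> i; rewrite !mxE; have := abs_coord_le_enorm u i.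
    by rewrite u1 ler_norml => /andP[]; lra.
  by rewrite /f scalerA divff ?scale1r ?addrK // pnatr_eq0.
Qed.

Lemma sphere_lower_bound (f : 'cV[R]_d -> R) : continuous f ->
  (forall a u, 0 <= a -> f (a *: u) = a * f u) ->
  (forall u, u != 0 -> 0 < f u) ->
  exists2 c : R, 0 < c & forall u, c * enorm u <= f u.
Proof.
move=> fc fh fpos.
have f0 : f 0 = 0 by rewrite -(scale0r 0) fh // mul0r.
have [[v v1]|no] := pselect ([set u : 'cV[R]_d | enorm u = 1] !=set0); last first.
  exists 1 => // u; have [->|u0] := eqVneq u 0; first by rewrite enorm0 mulr0 f0.
  have un0 : 0 < enorm u by rewrite enorm_gt0.
  exfalso; apply: no; exists ((enorm u)^-1 *: u) => /=.
  by rewrite enormZ ger0_norm ?invr_ge0 ?(ltW un0) // mulVf ?gt_eqF.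
have [w w1 wmin] : exists2 w, w \in [set u : 'cV[R]_d | enorm u = 1] &
    forall u, u \in [set u : 'cV[R]_d | enorm u = 1] -> f w <= f u.
  apply: compact_EVT_min; first by exists v.
    exact: compact_sphere.
  exact: continuous_subspaceT.
rewrite inE /= in w1; exists (f w).
  by apply: fpos; rewrite -enorm_gt0 w1.
move=> u; have [->|u0] := eqVneq u 0; first by rewrite enorm0 mulr0 f0.
have un0 : 0 < enorm u by rewrite enorm_gt0.
have := wmin ((enorm u)^-1 *: u); rewrite inE /= enormZ.
rewrite ger0_norm ?invr_ge0 ?(ltW un0) // mulVf ?gt_eqF // => /(_ erefl).
by rewrite fh ?invr_ge0 ?(ltW un0) // mulrC ler_pdivlMr.
Qed.

(** A vertex is found as a point farthest from the origin. *)
Lemma Vert_nonempty X : convex_body X -> Vert X !=set0.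
Proof.
move=> [X0 Xc _].
have [p pX pmax] : exists2 p, p \in X & forall t, t \in X -> enorm t <= enorm p.
  by apply: compact_EVT_max => //; apply: continuous_subspaceT; exact: continuous_enorm.
rewrite inE in pX.
have pmax' t : X t -> dot (t - p) (t - p) <= 2 * (dot p p - dot p t).
  move=> Xt; have := pmax t; rewrite inE => /(_ Xt); rewrite le_enorm.
  by rewrite !dotBl !dotBr (dotC t p); lra.
exists p, p; apply/seteqP; split=> [_ ->|t [Xt tmax]].
  by split=> // t /pmax'; have := dot_ge0 (t - p); lra.
apply/eqP; rewrite -subr_eq0 -dot_eq0 eq_le dot_ge0 andbT.
by apply: le_trans (pmax' t Xt) _; have := tmax p pX; lra.
Qed.

End SupportFunctions.

(** * Normal cones and interiors of zonotopes *)

Section ZonotopeGeometry.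
Variables (R : realType) (d n : nat).
Local Notation T := ('M[R]_(d, n) * 'cV[R]_d)%type.
Implicit Types (Q : 'M[R]_(d, n)) (mu u : 'cV[R]_d) (x y : 'cV[R]_n).

Lemma dot_genE Q u x : dot u (Q *m x) = \sum_i x i 0 * (Q^T *m u) i 0.
Proof. by rewrite dotC dot_mulmx dotE. Qed.

Lemma col_genE Q u i : (Q^T *m u) i 0 = dot (col i Q) u.
Proof. by rewrite mxE dotE; apply: eq_bigr => k _; rewrite !mxE. Qed.

Lemma convex_body_zonotope Q mu : convex_body (zonotope Q mu).
Proof.
split.
- by exists (Q *m 0 + mu), 0 => // i; rewrite mxE lexx ler01.
- apply: continuous_compact; last exact: compact_cube.
  apply: continuous_subspaceT => x; apply: continuousD; last exact: cst_continuous.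
  exact: continuous_mulmxl.
- move=> _ _ t [x xc <-] [y yc <-] /andP[t0 t1].
  exists (x + t *: (y - x)).
    move=> i; rewrite !mxE; have /andP[x0 x1] := xc i; have /andP[y0 y1] := yc i.
    by apply/andP; split; nra.
  by rewrite mulmxDr -scalemxAr mulmxBr opprD addrACA subrr addr0 addrAC.
Qed.

Lemma closed_zonotope Q mu : closed (zonotope Q mu).
Proof.
have [_ c _] := convex_body_zonotope Q mu.
by apply: compact_closed => //; exact: norm_hausdorff.
Qed.

(** The cube is a product, so it is enough to vary the coordinates one at a time. *)
Lemma normal_cone_zonotopeP Q mu x u : cube x ->
  normal_cone (zonotope Q mu) (Q *m x + mu) u <->
  forall i, (x i 0 < 1 -> (Q^T *m u) i 0 <= 0) /\ (0 < x i 0 -> 0 <= (Q^T *m u) i 0).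
Proof.
move=> xc; split=> [Nu i|ux].
  have step c : 0 <= c <= 1 -> (c - x i 0) * (Q^T *m u) i 0 <= 0.
    move=> c01; pose y := x + (c - x i 0) *: delta_mx i 0.
    have := Nu (Q *m y + mu); rewrite opprD addrACA subrr addr0 -mulmxBr.
    rewrite /y addrAC subrr add0r -scalemxAr dotZr -colE dotC -col_genE; apply.
    exists y => // j; rewrite !mxE eqxx andbT.
    by case: eqP => [->|_]; rewrite ?mulr1 ?mulr0 ?addr0 // addrCA subrr addr0.
  split=> xi.
    have := step 1; rewrite ler01 lexx => /(_ isT).
    by rewrite pmulr_rle0 // subr_gt0.
  have := step 0; rewrite ler01 lexx => /(_ isT).
  by rewrite sub0r mulNr oppr_le0 pmulr_rge0.
move=> _ [y yc <-]; rewrite opprD addrACA subrr addr0 -mulmxBr dot_genE.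
apply: sumr_le0 => i _; rewrite !mxE -/((Q^T *m u) i 0).
have [lt1 gt0] := ux i; have /andP[x0 x1] := xc i; have /andP[y0 y1] := yc i.
have [xi1|xi1] := ltP (x i 0) 1; last first.
  by have := gt0 (lt_le_trans ltr01 xi1); rewrite mxE; nra.
have := lt1 xi1; rewrite mxE; have [xi0|xi0] := ltP 0 (x i 0); last by nra.
by have := gt0 xi0; rewrite mxE => *; nra.
Qed.

(** With [sg = 1] this is the support function of the zonotope, and with [mu - q]
for [mu] its excess over [q].  With signs for [sg] the sum measures by how much
the products of [u] with the generators violate the opposite sign pattern. *)
Definition support (sg : 'I_n -> R) Q mu u :=
  \sum_i Num.max 0 (sg i * (Q^T *m u) i 0) + dot u mu.

Lemma zonotope_le_support Q mu x u : cube x ->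
  dot u (Q *m x + mu) <= support (fun=> 1) Q mu u.
Proof.
move=> xc; rewrite dotDr lerD2r dot_genE; apply: ler_sum => i _.
rewrite mul1r le_max; have /andP[x0 x1] := xc i.
have [s0|/ltW s0] := leP 0 ((Q^T *m u) i 0); last by rewrite mulr_ge0_le0.
by rewrite ler_piMl ?orbT.
Qed.

Lemma zonotope_support Q mu u :
  exists2 z, zonotope Q mu z & dot u z = support (fun=> 1) Q mu u.
Proof.
pose x : 'cV[R]_n := \col_i (if 0 <= (Q^T *m u) i 0 then 1 else 0).
exists (Q *m x + mu); first by exists x => // i; rewrite mxE; case: ifP; rewrite lexx ler01.
rewrite dotDr dot_genE; congr (_ + _); apply: eq_bigr => i _; rewrite mxE mul1r.
by case: leP => _; rewrite ?mul1r ?mul0r.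
Qed.

Lemma support_continuous sg Q mu : continuous (support sg Q mu).
Proof.
move=> u; have c2 : {for u, continuous (fun u => dot u mu)}.
  by apply: continuous_dot; [exact: cvg_id|exact: cst_continuous].
have c1 : {for u, continuous (fun u => \sum_i Num.max 0 (sg i * (Q^T *m u) i 0))}.
  apply: continuous_sumr => i; apply: continuous_max; first exact: cst_continuous.
  apply: continuousM; first exact: cst_continuous.
  apply: (@continuous_comp _ _ _ (fun u => Q^T *m u) (fun v : 'cV[R]_n => v i 0)).
    exact: continuous_mulmxl.
  exact: coord_continuous.
exact: continuousD c1 c2.
Qed.

Lemma supportZ sg Q mu a u : 0 <= a -> support sg Q mu (a *: u) = a * support sg Q mu u.
Proof.
move=> a0; rewrite /support mulrDr dotZl mulr_sumr; congr (_ + _).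
apply: eq_bigr => i _; rewrite -scalemxAr mxE mulrCA.
by rewrite -{1}(mulr0 a) maxr_pMr.
Qed.

(** The support function is Lipschitz in the generators, with a constant
proportional to the norm of the direction; hence a uniform lower bound on the
sphere survives a small perturbation. *)
Lemma support_lower_bound_near sg (Q0 : 'M[R]_(d, n)) mu0 q c : 0 < c ->
  (forall u, c * enorm u <= support sg Q0 (mu0 - q) u) ->
  \forall Z \near (Q0, mu0), forall u, c / 2 * enorm u <= support sg Z.1 (Z.2 - q) u.
Proof.
move=> c0 lb.
pose D (Z : T) := \sum_i `|sg i| * enorm (col i (Z.1 - Q0)) + enorm (Z.2 - mu0).
have D0 : D (Q0, mu0) = 0.
  rewrite /D /= !subrr enorm0 addr0 big1 // => i _.
  rewrite (_ : col i 0 = 0) ?enorm0 ?mulr0 //; exact: linear0.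
have Dc : {for (Q0, mu0), continuous D}.
  have c1 : {for (Q0, mu0), continuous (fun Z : T => Z.1)} by exact: cvg_fst.
  have c2 : {for (Q0, mu0), continuous (fun Z : T => Z.2)} by exact: cvg_snd.
  apply: continuousD; last first.
    apply: (@continuous_comp _ _ _ (fun Z : T => Z.2 - mu0)); last exact: continuous_enorm.
    by apply: continuousB => //; exact: cst_continuous.
  apply: continuous_sumr => i; apply: continuousM; first exact: cst_continuous.
  apply: (@continuous_comp _ _ _ (fun Z : T => col i (Z.1 - Q0))); last exact: continuous_enorm.
  apply: continuous_mx => k l.
  under [X in {for _, continuous X}]eq_fun do rewrite !mxE.
  apply: continuousB; last exact: cst_continuous.
  apply: (@continuous_comp _ _ _ (fun Z : T => Z.1) (fun A : 'M[R]_(d, n) => A k i)) => //.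
  exact: coord_continuous.
have : \forall Z \near (Q0, mu0), D Z < c / 2.
  apply: near_lt => //; first exact: cst_continuous.
  by rewrite D0 divr_gt0.
apply: filterS => -[Q mu] /= DZ u.
have := lb u; have := enorm_ge0 u.
suff : support sg Q0 (mu0 - q) u - support sg Q (mu - q) u <= D (Q, mu) * enorm u.
  by nra.
rewrite /support opprD addrACA /D mulrDl; apply: lerD.
  rewrite -sumrB mulr_suml; apply: ler_sum => i _.
  have h : sg i * (Q0^T *m u) i 0 - sg i * (Q^T *m u) i 0 <=
      `|sg i| * enorm (col i (Q - Q0)) * enorm u.
    rewrite -mulrBr -mulrA (le_trans (ler_norm _)) // normrM ler_wpM2l //.
    rewrite !col_genE -dotBl -linearB /= -(opprB Q Q0) linearN /= dotNl normrN.
    rewrite ler_norml cauchy_schwarz andbT lerNl -dotNl -(enormN (col _ _)).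
    exact: cauchy_schwarz.
  have h0 : 0 <= `|sg i| * enorm (col i (Q - Q0)) * enorm u.
    by rewrite !mulr_ge0 ?enorm_ge0.
  rewrite lerBlDr; case: (leP 0 (sg i * (Q0^T *m u) i 0)) => h1.
    have : sg i * (Q^T *m u) i 0 <= Num.max 0 (sg i * (Q^T *m u) i 0).
      by rewrite le_max lexx orbT.
    by move=> hmax; rewrite /=; lra.
  by rewrite addr_ge0 // le_max lexx.
rewrite -dotBr opprB addrA subrK mulrC (le_trans (cauchy_schwarz _ _)) //.
by rewrite -(opprB mu0 mu) enormN.
Qed.

Lemma interior_zonotopeP Q mu q :
  (zonotope Q mu)° q <->
  exists2 c : R, 0 < c & forall u, c * enorm u <= support (fun=> 1) Q (mu - q) u.
Proof.
have supE u : support (fun=> 1) Q (mu - q) u = support (fun=> 1) Q mu u - dot u q.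
  by rewrite /support dotBr addrA.
split=> [/support_of_interior[r r0 rX]|[c c0 cX]].
  exists r => // u; have [_ [x xc <-] h] := rX u.
  have := zonotope_le_support Q mu u xc; rewrite supE; lra.
apply/interior_enormP; exists c => //.
apply: ball_sub_of_support; first exact: convex_body_zonotope.
move=> u; have [z Zz zE] := zonotope_support Q mu u; exists z => //.
by have := cX u; rewrite supE zE; lra.
Qed.

(** Interiority is a positive lower bound of the excess of the support function
on the sphere, so it is stable under perturbation of the zonotope. *)
Lemma interior_zonotope_near (Q0 : 'M[R]_(d, n)) mu0 q : (zonotope Q0 mu0)° q ->
  \forall Z \near (Q0, mu0), (zonotope Z.1 Z.2)° q.
Proof.
move=> /interior_zonotopeP[c c0 cX].
have := support_lower_bound_near c0 cX.
apply: filterS => Z h; apply/interior_zonotopeP; exists (c / 2) => //.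
by rewrite divr_gt0.
Qed.

(** Otherwise the excess of the support function over [q] would be positive on the
sphere, hence bounded below, and [q] would be an interior point. *)
Lemma supporting_hyperplane Q mu q : ~ (zonotope Q mu)° q ->
  exists2 u, u != 0 & normal_cone (zonotope Q mu) q u.
Proof.
move=> nint; apply: contrapT => no; apply: nint; apply/interior_zonotopeP.
apply: sphere_lower_bound; first exact: support_continuous.
  by move=> a u a0; exact: supportZ.
move=> u u0; rewrite ltNge; apply/negP => h; apply: no; exists u => //.
move=> _ [x xc <-]; rewrite dotBr; apply: le_trans h.
rewrite [leRHS](_ : _ = support (fun=> 1) Q mu u - dot u q); last first.
  by rewrite /support dotBr addrA.
by rewrite lerD2r; exact: zonotope_le_support.
Qed.

Lemma interior_normal0 (X : set 'cV[R]_d) q u : X° q -> normal_cone X q u -> u = 0.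
Proof.
move=> /support_of_interior[r r0 /(_ u)[z Xz h]] Nu.
apply/eqP; rewrite -[_ == 0]negbK -enorm_gt0 -leNgt.
by have := Nu z Xz; rewrite dotBr; nra.
Qed.

(** Compactness of the sphere makes the failure of a sign pattern robust. *)
Lemma no_weak_sign_near (sg : 'I_n -> R) (Q0 : 'M[R]_(d, n)) (mu0 : 'cV[R]_d) :
  ~ (exists2 u : 'cV[R]_d, u != 0 & forall i, 0 <= sg i * (Q0^T *m u) i 0) ->
  \forall Z \near (Q0, mu0),
    ~ (exists2 u : 'cV[R]_d, u != 0 & forall i, 0 <= sg i * (Z.1^T *m u) i 0).
Proof.
move=> no; pose f := support (fun i => - sg i) Q0 (mu0 - mu0).
have [c c0 fc] : exists2 c : R, 0 < c & forall u, c * enorm u <= f u.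
  apply: sphere_lower_bound; first exact: support_continuous.
    by move=> a u a0; exact: supportZ.
  move=> u u0; rewrite /f /support subrr dot0r addr0 lt_neqAle.
  rewrite sumr_ge0 ?andbT => [|i _]; last by rewrite le_max lexx.
  apply/eqP => /esym/eqP; rewrite psumr_eq0 => [/allP z|i _]; last by rewrite le_max lexx.
  apply: no; exists u => // i; have := z i (mem_index_enum i).
  by rewrite /= => /eqP/max_idPl; rewrite mulNr oppr_le0.
have := support_lower_bound_near c0 fc.
have : \forall Z \near (Q0, mu0), enorm (Z.2 - mu0) < c / 2.
  apply: near_lt; last by rewrite /= subrr enorm0 divr_gt0.
    apply: (@continuous_comp _ _ _ (fun Z : T => Z.2 - mu0)); last exact: continuous_enorm.
    by apply: continuousB; [exact: cvg_snd|exact: cst_continuous].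
  exact: cst_continuous.
apply: filterS2 => -[Q mu] /= mulc lb [u u0 us].
have := lb u; rewrite /support big1 => [|i _]; last first.
  by rewrite mulNr max_l // oppr_le0.
have un0 : 0 < enorm u by rewrite enorm_gt0.
have := cauchy_schwarz u (mu - mu0); rewrite add0r; nra.
Qed.

End ZonotopeGeometry.

(** * Least squares and general position *)

Section LeastSquares.
Variables (R : realType).

Lemma unitmx_ker n (A : 'M[R]_n) :
  (forall x : 'cV[R]_n, A *m x = 0 -> x = 0) -> A \in unitmx.
Proof.
move=> inj; rewrite -unitmx_tr unitmxE unitfE; apply/det0P => -[v v0 vA].
move/eqP: v0; apply; apply: trmx_inj; rewrite trmx0; apply: inj.
by rewrite -[A]trmxK -trmx_mul vA trmx0.
Qed.

(** A vector killed by [W^T *m W] is killed by [W], because a sum of squares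
vanishes only if all its terms do; so both matrices have the same row space. *)
Lemma normal_equations d m (W : 'M[R]_(d, m)) :
  exists M : 'M[R]_(m, d), W^T *m (W *m M) = W^T.
Proof.
have sub : (W <= W^T *m W)%MS.
  rewrite submxE; set K := cokermx _; apply/eqP.
  have h : W^T *m (W *m K) = 0 by rewrite mulmxA mulmx_coker.
  have : (W *m K)^T *m (W *m K) = 0 by rewrite trmx_mul -mulmxA h mulmx0.
  move=> /matrixP g; apply/matrixP => i j; rewrite [RHS]mxE.
  have := g j j; rewrite !mxE.
  have c0 : dot (col j (W *m K)) (col j (W *m K)) = 0 -> (W *m K) i j = 0.
    move=> /eqP; rewrite dot_eq0 => /eqP/matrixP/(_ i 0).
    by rewrite !mxE.
  move=> e; rewrite -[RHS]c0 ?mxE //; rewrite dotE -[RHS]e.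
  by apply: eq_bigr => k _; rewrite !mxE.
have [M /(congr1 trmx)] := submxP sub.
by rewrite !trmx_mul trmxK => e; exists M^T; rewrite mulmxA.
Qed.

End LeastSquares.

Section GeneralPosition.
Variables (R : realType) (d n : nat).
Implicit Types (Q : 'M[R]_(d, n)) (u w : 'cV[R]_d) (x y t : 'cV[R]_n).
Implicit Types (S : {set 'I_n}).

(** Coefficient vectors are indexed by all generators, whatever [S] is, so that the
matrices below have a fixed size. *)
Definition indep_on Q S := forall x,
  (forall i, i \notin S -> x i 0 = 0) -> Q *m x = 0 -> x = 0.

Lemma mulmx_cols Q x : Q *m x = \sum_i x i 0 *: col i Q.
Proof.
apply/matrixP => k j; rewrite ord1 mxE summxE.
by apply: eq_bigr => i _; rewrite !mxE mulrC.
Qed.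

Definition gen_tuple Q S := map_tuple (fun i => col i Q) (enum_tuple S).

Lemma nth_gen_tuple Q S (k : 'I_#|S|) : (gen_tuple Q S)`_k = col (enum_val k) Q.
Proof.
rewrite -tnth_nth tnth_map (tnth_nth (enum_val k)) /=; congr (col _ Q).
by rewrite [in RHS](enum_val_nth (enum_val k)).
Qed.

Lemma general_position_indep Q S : general_position Q -> (#|S| <= d)%N ->
  indep_on Q S.
Proof.
move=> gp Sd x x0 Qx.
have : free (gen_tuple Q S) := gp S Sd.
move=> /freeP fr; apply/matrixP => i j; rewrite ord1 [RHS]mxE.
have [iS|/x0//] := boolP (i \in S).
have := fr (fun k => x (enum_val k) 0) _ (enum_rank_in iS i).
rewrite enum_rankK_in //; apply.
under eq_bigr do rewrite nth_gen_tuple.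
rewrite -(big_enum_val (fun i => x i 0 *: col i Q)) -[RHS]Qx mulmx_cols.
rewrite big_mkcond; apply: eq_bigr => k _.
by case: ifPn => // /x0 ->; rewrite scale0r.
Qed.

Definition orth_gens Q u : {set 'I_n} := [set i | (Q^T *m u) i 0 == 0]%SET.

(** [d] generators in general position span the space, so fewer than [d] of
them are orthogonal to a given nonzero vector. *)
Lemma general_position_normal Q u : general_position Q -> u != 0 ->
  (#|orth_gens Q u| < d)%N.
Proof.
move=> gp u0; rewrite ltnNge; apply/negP => cd; case/negP: u0.
set S0 := orth_gens Q u in cd; pose S : {set 'I_n} := [set i in take d (enum S0)]%SET.
have cS : #|S| = d.
  rewrite cardsE; have /card_uniqP -> : uniq (take d (enum S0)).
    by rewrite take_uniq // enum_uniq.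
  by rewrite size_takel // -cardE.
have SS0 i : i \in S -> (Q^T *m u) i 0 = 0.
  by rewrite inE => /mem_take; rewrite mem_enum inE => /eqP.
have fr : free (gen_tuple Q S) by apply: (gp S); rewrite cS.
have /span_basis spn : basis_of fullv (gen_tuple Q S).
  by rewrite basisEfree fr subvf size_tuple cS dimvf dim_matrix mulr1 leqnn.
have /coord_span uE : u \in <<gen_tuple Q S>>%VS by rewrite spn memvf.
rewrite -dot_eq0 [X in dot X u]uE dot_suml big1 // => k _.
by rewrite dotZl nth_gen_tuple -col_genE SS0 ?mulr0 // enum_valP.
Qed.

Lemma general_position_indep_normal Q u : general_position Q -> u != 0 ->
  indep_on Q (orth_gens Q u).
Proof.
by move=> gp u0; apply: general_position_indep => //; apply/ltnW/general_position_normal.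
Qed.

Definition coord_proj S : 'M[R]_n := diag_mx (\row_i (i \in S)%:R).

Lemma coord_projE S x i : (coord_proj S *m x) i 0 = if i \in S then x i 0 else 0.
Proof. by rewrite mul_diag_mx !mxE; case: ifP; rewrite ?mul1r ?mul0r. Qed.

Lemma coord_proj_idem S : coord_proj S *m coord_proj S = coord_proj S.
Proof.
apply/matrixP => i j; rewrite mul_diag_mx !mxE.
by case: (i \in S); rewrite ?mul1r ?mul0r ?mul0rn.
Qed.

Lemma tr_coord_proj S : (coord_proj S)^T = coord_proj S.
Proof. exact: tr_diag_mx. Qed.

(** The Gram matrix of the generators in [S], padded by the identity so that it
is square of a size independent of [S]. *)
Definition gram Q S : 'M[R]_n :=
  coord_proj S *m Q^T *m Q *m coord_proj S + (1%:M - coord_proj S).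

(** The quadratic form of [gram Q S] is a sum of two squares, one of which sees
the coordinates in [S] and the other one those outside. *)
Lemma gram_unit Q S : indep_on Q S -> gram Q S \in unitmx.
Proof.
move=> ind; apply: unitmx_ker => x Hx; set D := coord_proj S.
have DD : D *m (1%:M - D) = 0 by rewrite mulmxBr mulmx1 coord_proj_idem subrr.
have h1 : dot (Q *m (D *m x)) (Q *m (D *m x)) = dot x (D *m Q^T *m Q *m D *m x).
  by rewrite !dot_mulmx tr_coord_proj !mulmxA.
have h2 : dot ((1%:M - D) *m x) ((1%:M - D) *m x) = dot x ((1%:M - D) *m x).
  rewrite dot_mulmx linearB /= trmx1 tr_coord_proj mulmxA.
  by rewrite mulmxBl mul1mx DD subr0.
have : dot x (gram Q S *m x) = 0 by rewrite Hx dot0r.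
rewrite /gram mulmxDl dotDr -h1 -h2 => /eqP.
rewrite paddr_eq0 ?dot_ge0 // !dot_eq0 => /andP[/eqP QDx /eqP x1].
have : D *m x = 0 by apply: ind => // i iS; rewrite coord_projE (negbTE iS).
by move: x1; rewrite mulmxBl mul1mx => /subr0_eq xD; rewrite {2}xD.
Qed.

Lemma gram_solve Q S (b : 'cV[R]_n) : gram Q S \in unitmx -> let D := coord_proj S in
  D *m Q^T *m (Q *m (D *m (invmx (gram Q S) *m b))) = D *m b.
Proof.
move=> Hu D; have DH : D *m gram Q S = D *m Q^T *m Q *m D.
  rewrite /gram mulmxDr mulmxBr mulmx1 coord_proj_idem subrr addr0 !mulmxA.
  by rewrite coord_proj_idem.
by rewrite -[in RHS](mulKVmx Hu b) [RHS]mulmxA DH !mulmxA.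
Qed.

Lemma indep_dual Q S t : indep_on Q S ->
  exists w, forall i, i \in S -> (Q^T *m w) i 0 = t i 0.
Proof.
move=> ind; exists (Q *m (coord_proj S *m (invmx (gram Q S) *m t))) => i iS.
have /matrixP/(_ i 0) := gram_solve t (gram_unit ind).
by rewrite -[_ *m Q^T *m _]mulmxA !coord_projE iS.
Qed.

Definition residual_coord Q S w : 'cV[R]_n :=
  coord_proj S *m (invmx (gram Q S) *m (coord_proj S *m (Q^T *m w))).

(** The component of [w] orthogonal to the generators in [S], once their Gram
matrix is invertible. *)
Definition residual Q S w : 'cV[R]_d := w - Q *m residual_coord Q S w.

Lemma residual_orth Q S w i : gram Q S \in unitmx -> i \in S ->
  (Q^T *m residual Q S w) i 0 = 0.
Proof.
move=> Hu iS; have := gram_solve (coord_proj S *m (Q^T *m w)) Hu.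
rewrite /= [RHS]mulmxA coord_proj_idem -mulmxA => /matrixP/(_ i 0).
rewrite !coord_projE iS => h.
by rewrite /residual mulmxBr [LHS]mxE [X in _ + X]mxE /residual_coord h subrr.
Qed.

Lemma residual_coord_out Q S w i : i \notin S -> residual_coord Q S w i 0 = 0.
Proof. by move=> iS; rewrite coord_projE (negbTE iS). Qed.

Lemma residual_coord0 Q S w : (forall i, i \in S -> (Q^T *m w) i 0 = 0) ->
  residual_coord Q S w = 0.
Proof.
move=> w0; rewrite /residual_coord (_ : coord_proj S *m (Q^T *m w) = 0).
  by rewrite !mulmx0.
by apply/matrixP => i j; rewrite ord1 coord_projE [RHS]mxE; case: ifP => // /w0.
Qed.

Lemma indep_on_sub Q (S S' : {set 'I_n}) : S \subset S' -> indep_on Q S' -> indep_on Q S.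
Proof.
move=> SS ind x x0; apply: ind => i iS; apply: x0.
by apply: contra iS => /(fintype.subsetP SS).
Qed.

(** Move [u] along a vector dual to the generators orthogonal to it, by a step too
short to change the sign of a nonzero product. *)
Lemma perturb_normal Q u (t : 'I_n -> R) : indep_on Q (orth_gens Q u) ->
  exists e u', [/\ 0 < e, u != 0 -> u' != 0,
    forall i, (Q^T *m u) i 0 = 0 -> (Q^T *m u') i 0 = e * t i,
    forall i, 0 < (Q^T *m u) i 0 -> 0 < (Q^T *m u') i 0
  & forall i, (Q^T *m u) i 0 < 0 -> (Q^T *m u') i 0 < 0].
Proof.
move=> ind; have [w wt] := indep_dual (\col_i t i) ind.
(* [Some i] bounds the change of the [i]-th product; [None] keeps [dot u u']
   positive, so that [u'] does not vanish *)
pose c (k : option 'I_n) := if k is Some i then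
  (if (Q^T *m u) i 0 == 0 then 1 else `|(Q^T *m u) i 0|) else if u == 0 then 1 else dot u u.
pose b (k : option 'I_n) := if k is Some i then `|(Q^T *m w) i 0| else - dot u w.
have c0 k : 0 < c k.
  by case: k => [i|] /=; case: ifPn => //; rewrite ?normr_gt0 ?dot_gt0.
have [e e0 ebc] := small_multiple b c0.
have sE i : (Q^T *m (u + e *: w)) i 0 = (Q^T *m u) i 0 + e * (Q^T *m w) i 0.
  by rewrite mulmxDr -scalemxAr [LHS]mxE [X in _ + X]mxE.
have eb i : (Q^T *m u) i 0 != 0 -> `|e * (Q^T *m w) i 0| < `|(Q^T *m u) i 0|.
  by move=> /negbTE ui; have := ebc (Some i); rewrite /= ui normrM (gtr0_norm e0).
exists e, (u + e *: w); split => //.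
- move=> u0; apply/eqP => z; have := ebc None; rewrite /= (negbTE u0) mulrN -dotZr.
  have := dot0r u; rewrite -z dotDr; lra.
- by move=> i ui; rewrite sE ui add0r wt ?mxE // inE ui eqxx.
- move=> i ui; rewrite sE; have := eb i; rewrite gt_eqF // => /(_ isT).
  by rewrite (gtr0_norm ui) ltr_norml => /andP[]; lra.
- move=> i ui; rewrite sE; have := eb i; rewrite lt_eqF // => /(_ isT).
  by rewrite (ltr0_norm ui) ltr_norml => /andP[]; lra.
Qed.

End GeneralPosition.

(** * Orthogonal projections depend rationally on the generators *)

Section ResidualsNear.
Variables (R : realType) (d n : nat) (Z0 : 'M[R]_(d, n) * 'cV[R]_d) (S : {set 'I_n}).
Local Notation T := ('M[R]_(d, n) * 'cV[R]_d)%type.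
Hypothesis ind : indep_on Z0.1 S.

Lemma rational_gram : rational_mx Z0 (fun Z : T => gram Z.1 S).
Proof.
apply: rational_mxD; last exact: rational_mx_cst.
apply: rational_mxM; last exact: rational_mx_cst.
apply: rational_mxM; last exact: rational_mx_gen.
apply: rational_mxM; first exact: rational_mx_cst.
by apply: rational_trmx; exact: rational_mx_gen.
Qed.

Lemma gram_unit_near : \forall Z \near Z0, gram Z.1 S \in unitmx.
Proof.
have := near_neq0 (rational_continuous (rational_det rational_gram)).
rewrite -unitfE -unitmxE gram_unit // => /(_ isT).
by apply: filterS => Z; rewrite unitmxE unitfE.
Qed.

Lemma rational_residual_coord (w : T -> 'cV[R]_d) : rational_mx Z0 w ->
  rational_mx Z0 (fun Z => residual_coord Z.1 S (w Z)).
Proof.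
move=> rw; apply: rational_mxM; first exact: rational_mx_cst.
apply: rational_mxM.
  by apply: rational_invmx; [exact: rational_gram|exact: gram_unit].
apply: rational_mxM; first exact: rational_mx_cst.
by apply: rational_mxM => //; apply: rational_trmx; exact: rational_mx_gen.
Qed.

Lemma rational_residual (w : T -> 'cV[R]_d) : rational_mx Z0 w ->
  rational_mx Z0 (fun Z => residual Z.1 S (w Z)).
Proof.
move=> rw; apply: rational_mxB => //; apply: rational_mxM.
  exact: rational_mx_gen.
exact: rational_residual_coord.
Qed.

End ResidualsNear.

(** * Pushforward of vertices and of boundary points *)

Lemma near_forall (T : topologicalType) (I : finType) (Z0 : T) (Pr : I -> T -> Prop) :
  (forall i, \forall Z \near Z0, Pr i Z) -> \forall Z \near Z0, forall i, Pr i Z.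
Proof. exact: filter_forall. Qed.

Section Pushforward.
Variables (R : realType) (d n : nat).
Local Notation T := ('M[R]_(d, n) * 'cV[R]_d)%type.
Implicit Types (Q : 'M[R]_(d, n)) (mu u p q : 'cV[R]_d) (x y : 'cV[R]_n).
Implicit Types (e S : {set 'I_n}).

Lemma lift_ptP Q mu q : zonotope Q mu q ->
  cube (lift_pt Q mu q) /\ Q *m lift_pt Q mu q + mu = q.
Proof.
move=> [x xc xq].
by apply: (@xgetPex _ 0 [set x | cube x /\ Q *m x + mu = q]); exists x.
Qed.

Lemma zpushforward_in (Q0 : 'M[R]_(d, n)) mu0 Q mu q : zonotope Q0 mu0 q ->
  zonotope Q mu (zpushforward Q0 mu0 Q mu q).
Proof. by move=> /lift_ptP[c _]; exists (lift_pt Q0 mu0 q). Qed.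

Definition corner e : 'cV[R]_n := \col_i (if i \in e then 1 else 0).

Definition sign_of e i : R := if i \in e then 1 else -1.

Lemma cube_corner e : cube (corner e).
Proof. by move=> i; rewrite mxE; case: ifP; rewrite lexx ler01. Qed.

Lemma corner_unique_max Q u e x : (forall i, 0 < sign_of e i * (Q^T *m u) i 0) ->
  cube x -> dot u (Q *m corner e) <= dot u (Q *m x) -> x = corner e.
Proof.
move=> sg xc; rewrite !dot_genE -subr_ge0 -sumrB => h.
have term i : x i 0 * (Q^T *m u) i 0 - corner e i 0 * (Q^T *m u) i 0 <= 0.
  rewrite /corner [X in _ - X * _]mxE; have := sg i; rewrite /sign_of.
  by have /andP[x0 x1] := xc i; case: (i \in e); nra.
have : \sum_i (corner e i 0 * (Q^T *m u) i 0 - x i 0 * (Q^T *m u) i 0) == 0.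
  rewrite eq_le sumr_ge0 ?andbT => [|i _]; last by have := term i; lra.
  by rewrite -oppr_ge0 -sumrN; under eq_bigr do rewrite opprB.
rewrite psumr_eq0 => [/allP z|i _]; last by have := term i; lra.
apply/matrixP => i j; rewrite ord1; have := z i (mem_index_enum i).
rewrite /= -mulrBl mulf_eq0 => /orP[/eqP|/eqP z0]; first by lra.
by have := sg i; rewrite z0 mulr0 ltxx.
Qed.

Lemma corner_vertex Q mu u e : (forall i, 0 < sign_of e i * (Q^T *m u) i 0) ->
  Vert (zonotope Q mu) (Q *m corner e + mu) /\
  lift_pt Q mu (Q *m corner e + mu) = corner e.
Proof.
move=> sg; have Zc : zonotope Q mu (Q *m corner e + mu).
  by exists (corner e) => //; exact: cube_corner.
split; last first.
  have [lc lE] := lift_ptP Zc; apply: corner_unique_max sg lc _.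
  by move/addIr: lE => ->.
exists u; apply/seteqP; split=> [_ ->|_ [[x xc <-] xmax]].
  split=> // _ [x xc <-]; rewrite !dotDr lerD2r leNgt; apply/negP => lt.
  by move: (lt); rewrite (corner_unique_max sg xc (ltW lt)) ltxx.
have := xmax _ Zc; rewrite !dotDr lerD2r => h.
by rewrite (corner_unique_max sg xc h).
Qed.

(** The sign pattern of a nonzero functional on the generators of a nearby
zonotope already occurs weakly for [Q0], hence strictly after a perturbation.
So nearby zonotopes have no vertices but the pushed forward ones. *)
Lemma vertices_dominate_near (Q0 : 'M[R]_(d, n)) mu0 : general_position Q0 ->
  \forall Z \near (Q0, mu0), forall u, u != 0 ->
    exists2 q, Vert (zonotope Q0 mu0) q &
      forall z, zonotope Z.1 Z.2 z -> dot u z <= dot u (zpushforward Q0 mu0 Z.1 Z.2 q).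
Proof.
move=> gp.
pose V e := Vert (zonotope Q0 mu0) (Q0 *m corner e + mu0) /\
  lift_pt Q0 mu0 (Q0 *m corner e + mu0) = corner e.
have : \forall Z \near (Q0, mu0), forall e, V e \/
    ~ (exists2 u : 'cV[R]_d, u != 0 & forall i, 0 <= sign_of e i * (Z.1^T *m u) i 0).
  apply: near_forall => e.
  have [[u u0 us]|no] := pselect (exists2 u : 'cV[R]_d, u != 0 &
      forall i, 0 <= sign_of e i * (Q0^T *m u) i 0); last first.
    have := @no_weak_sign_near _ _ _ (sign_of e) Q0 mu0 no.
    by apply: filterS => Z; right.
  suff Ve : V e by near=> Z; left.
  have [ep [u' [ep0 _ u'0 u'p u'n]]] := perturb_normal (sign_of e)
    (general_position_indep_normal gp u0).
  apply: (@corner_vertex _ _ u') => i; have := us i.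
  have [ui|ui|ui] := ltgtP ((Q0^T *m u) i 0) 0.
  - have := u'n i ui; rewrite /sign_of; case: (i \in e); nra.
  - have := u'p i ui; rewrite /sign_of; case: (i \in e); nra.
  - move=> _; rewrite u'0 // mulrCA -expr2 mulr_gt0 // exprn_even_gt0 //=.
    by rewrite /sign_of; case: (i \in e); rewrite ?oppr_eq0 oner_neq0.
apply: filterS => Z h u u0; pose e : {set 'I_n} := [set i | 0 <= (Z.1^T *m u) i 0]%SET.
have [[Ve le]|no] := h e; last first.
  exfalso; apply: no; exists u => // i; rewrite /sign_of inE.
  by case: (leP 0 ((Z.1^T *m u) i 0)) => ui; rewrite ?mul1r // mulN1r oppr_ge0 ltW.
exists (Q0 *m corner e + mu0) => // _ [x xc <-].
rewrite /zpushforward le !dotDr lerD2r !dot_genE; apply: ler_sum => i _.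
rewrite [corner e i 0]mxE inE; have /andP[x0 x1] := xc i.
by case: (leP 0 ((Z.1^T *m u) i 0)) => h0; nra.
Unshelve. all: by end_near. Qed.

(** The functional exposing the face with fractional coordinates [S] is kept
orthogonal to the generators in [S] by projection. *)
Lemma boundary_pattern_near (Q0 : 'M[R]_(d, n)) mu0 e S x0 : general_position Q0 ->
  cube x0 -> (forall i, i \in S <-> 0 < x0 i 0 < 1) ->
  (forall i, i \notin S -> x0 i 0 = corner e i 0) ->
  ~ (zonotope Q0 mu0)° (Q0 *m x0 + mu0) ->
  \forall Z \near (Q0, mu0), forall x, cube x ->
    (forall i, i \notin S -> x i 0 = corner e i 0) ->
    ~ (zonotope Z.1 Z.2)° (Z.1 *m x + Z.2).
Proof.
move=> gp c0 Sx0 ex0 /supporting_hyperplane[u u0 /(normal_cone_zonotopeP _ _ _ c0) Nu].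
have [ep [u' [ep0 /(_ u0) u'nz u'0 u'p u'n]]] := perturb_normal
  (fun i => if i \in S then 0 else sign_of e i) (general_position_indep_normal gp u0).
have u'S i : i \in S -> (Q0^T *m u') i 0 = 0.
  move=> iS; have /andP[xi0 xi1] := (Sx0 i).1 iS; have [le0 ge0] := Nu i.
  by rewrite u'0 ?iS ?mulr0 //; apply/eqP; rewrite eq_le le0 // ge0.
have u'e i : i \notin S -> 0 < sign_of e i * (Q0^T *m u') i 0.
  move=> iS; have := ex0 i iS; have [le0 ge0] := Nu i; rewrite mxE /sign_of.
  have := u'0 i; rewrite (negbTE iS) /sign_of; have := u'p i; have := u'n i.
  case: ifP => _ hn hp hz xi.
    rewrite mul1r; have := ge0; rewrite xi ltr01 le_eqVlt => /(_ isT) /orP[/eqP z|/hp//].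
    by rewrite hz // mulr1.
  rewrite mulN1r oppr_gt0; have := le0; rewrite xi ltr01 le_eqVlt => /(_ isT) /orP[/eqP z|/hn//].
  by rewrite hz // mulrN1 oppr_lt0.
have ind : indep_on Q0 S.
  apply: indep_on_sub (general_position_indep_normal gp u'nz).
  by apply/fintype.subsetP => i /u'S ui; rewrite inE ui eqxx.
pose r (Z : T) := residual Z.1 S u'.
have r0 : r (Q0, mu0) = u' by rewrite /r /residual residual_coord0 // mulmx0 subr0.
have rr : rational_mx (Q0, mu0) r by apply: rational_residual => //; exact: rational_mx_cst.
have unit_near := @gram_unit_near _ _ _ (Q0, mu0) _ ind.
have r_near : \forall Z \near (Q0, mu0), 0 < dot (r Z) (r Z).
  apply: near_lt; first exact: cst_continuous.
    by apply: rational_continuous; exact: rational_dot.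
  by rewrite r0 dot_gt0.
have e_near : \forall Z \near (Q0, mu0), forall i, i \notin S ->
    0 < sign_of e i * (Z.1^T *m r Z) i 0.
  apply: near_forall => i; have [iS|iS] := boolP (i \in S); first by near=> Z.
  have : \forall Z \near (Q0, mu0), 0 < sign_of e i * (Z.1^T *m r Z) i 0.
    apply: near_lt; [exact: cst_continuous| |by rewrite r0; exact: u'e].
    apply: rational_continuous; apply: rationalM; first exact: rational_cst.
    have rm : rational_mx (Q0, mu0) (fun Z : T => Z.1^T *m r Z).
      by apply: rational_mxM => //; apply: rational_trmx; exact: rational_mx_gen.
    exact: rm.
  by apply: filterS.
near=> Z => x xc xe Zint.
have : 0 < dot (r Z) (r Z) by near: Z.
rewrite dot_gt0 => /eqP; apply; apply: interior_normal0 Zint _.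
have Hu : gram Z.1 S \in unitmx by near: Z.
have eZ : forall i, i \notin S -> 0 < sign_of e i * (Z.1^T *m r Z) i 0 by near: Z.
apply/normal_cone_zonotopeP => // i; have [iS|iS] := boolP (i \in S).
  by rewrite residual_orth.
have := eZ i iS; rewrite xe // [corner e i 0]mxE /sign_of.
by case: ifP => _ ui; split=> ?; lra.
Unshelve. all: by end_near. Qed.

(** A boundary point is recorded by the set of coordinates of its lift equal to 1
and the set of its fractional ones; there are finitely many such patterns. *)
Lemma proper_near (Q0 : 'M[R]_(d, n)) mu0 : general_position Q0 ->
  \forall Z \near (Q0, mu0), forall q, frontier (zonotope Q0 mu0) q ->
    frontier (zonotope Z.1 Z.2) (zpushforward Q0 mu0 Z.1 Z.2 q).
Proof.
move=> gp.
pose pat (eS : {set 'I_n} * {set 'I_n}) x :=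
  (forall i, i \in eS.2 <-> 0 < x i 0 < 1) /\
  (forall i, i \notin eS.2 -> x i 0 = corner eS.1 i 0).
have : \forall Z \near (Q0, mu0), forall eS x0, cube x0 -> pat eS x0 ->
    ~ (zonotope Q0 mu0)° (Q0 *m x0 + mu0) ->
    ~ (zonotope Z.1 Z.2)° (Z.1 *m x0 + Z.2).
  apply: near_forall => eS.
  have [[x0 [c0 [p1 p2] b0]]|no] := pselect (exists x0, [/\ cube x0, pat eS x0 &
      ~ (zonotope Q0 mu0)° (Q0 *m x0 + mu0)]); last first.
    by near=> Z => x0 c0 p0 b0; exfalso; apply: no; exists x0.
  have := boundary_pattern_near gp c0 p1 p2 b0.
  by apply: filterS => Z h x xc [_ xp] _; exact: h.
apply: filterS => Z h q [].
rewrite -(closure_id _).1; last exact: closed_zonotope.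
move=> Zq nint; have [lc lE] := lift_ptP Zq; set x := lift_pt _ _ _ in lc lE.
split; first by apply: subset_closure; exact: zpushforward_in.
rewrite /zpushforward -/x.
apply: (h ([set i | x i 0 == 1]%SET, [set i | 0 < x i 0 < 1]%SET)); last by rewrite lE.
- exact: lc.
- split=> i /=; first by rewrite inE.
  rewrite !inE mxE inE; have /andP[x0 x1] := lc i.
  rewrite negb_and -!leNgt => /orP[xi|xi].
    have -> : x i 0 = 0 by apply/eqP; rewrite eq_le xi.
    by rewrite eq_sym oner_eq0.
  have -> : x i 0 = 1 by apply/eqP; rewrite eq_le x1.
  by rewrite eqxx.
Unshelve. all: by end_near. Qed.

End Pushforward.

Lemma col_addZE (R : pzRingType) m (x y : 'cV[R]_m) a i :
  (x + a *: y) i 0 = x i 0 + a * y i 0.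
Proof. by rewrite !mxE. Qed.

(** * Affine hulls as flats *)

Section AffineHulls.
Variables (R : realType) (d : nat).
Implicit Types (X : set 'cV[R]_d) (p b z : 'cV[R]_d).

Definition flat k b (L : 'M[R]_(d, k)) : set 'cV[R]_d :=
  [set z | exists y, z = b + L *m y].

Lemma Aff_sub X z : X z -> Aff X z.
Proof.
move=> Xz; exists 1, (fun=> 1), (fun=> z); split=> //.
  by rewrite big_ord_recl big_ord0 addr0.
by rewrite big_ord_recl big_ord0 addr0 scale1r.
Qed.

(** A set that contains a small segment from [b] in each direction of the flat
spans it: any point is an affine combination of [b] and a point of the set. *)
Lemma Aff_flat k X b (L : 'M[R]_(d, k)) : X b -> X `<=` flat b L ->
  (forall y, exists2 e, 0 < e & X (b + e *: (L *m y))) -> Aff X = flat b L.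
Proof.
move=> Xb XL Xe; apply/seteqP; split=> [_ [m [a [v [Xv a1 ->]]]]|_ [y ->]].
  have /choice[y vE] : forall i, exists y, v i = b + L *m y by move=> i; exact: XL.
  exists (\sum_i a i *: y i); rewrite mulmx_sumr -[b in RHS]scale1r -a1 scaler_suml.
  by rewrite -big_split; apply: eq_bigr => i _; rewrite vE scalerDr scalemxAr.
have [e e0 Xbe] := Xe y.
pose v (i : 'I_2) := if val i == 0 then b else b + e *: (L *m y).
pose a (i : 'I_2) := if val i == 0 then 1 - e^-1 else e^-1.
exists 2, a, v; split.
- by move=> i; rewrite /v; case: ifP.
- by rewrite !big_ord_recl big_ord0 /a /= addr0 subrK.
- rewrite !big_ord_recl big_ord0 /a /v /= addr0 scalerDr scalerA mulVf ?gt_eqF //.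
  by rewrite scale1r addrA -scalerDl subrK scale1r.
Qed.

Lemma dist_flat k b (L : 'M[R]_(d, k)) p y : L^T *m (p - (b + L *m y)) = 0 ->
  dist p (flat b L) = enorm (p - (b + L *m y)).
Proof.
move=> Lu; apply: dist_proj; split; first by exists y.
move=> _ [t ->]; have -> : b + L *m t - (b + L *m y) = L *m (t - y).
  by rewrite mulmxBr opprD addrACA subrr add0r.
by rewrite dotC dot_mulmx Lu dot0r.
Qed.

End AffineHulls.

Section LocalTerms.
Variables (R : realType) (d n : nat).
Local Notation T := ('M[R]_(d, n) * 'cV[R]_d)%type.

(** The two kinds of terms are reduced to this common form.  [h] is the distance to
the convex body itself that [t] stands for, and [reg] the condition under which
differentiability is claimed; the dichotomy under [reg] keeps the square root
away from its singularity. *)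
Definition local_sqrt_rational (Z0 : T) (t : 'M[R]_(d, n) -> 'cV[R]_d -> R)
    (h : T -> R) (reg : Prop) := exists g : T -> R,
  [/\ rational_near Z0 g, forall Z, 0 <= g Z,
      \forall Z \near Z0, t Z.1 Z.2 = Num.sqrt (g Z),
      reg -> 0 < g Z0 \/ \forall Z \near Z0, g Z = 0
    & \forall Z \near Z0, h Z = t Z.1 Z.2].

End LocalTerms.

(** * The term of a vertex of the polytope *)

Section PolytopeVertexTerm.
Variables (R : realType) (d n : nat).
Local Notation T := ('M[R]_(d, n) * 'cV[R]_d)%type.
Variables (Q0 : 'M[R]_(d, n)) (mu0 p : 'cV[R]_d).
Hypothesis gp : general_position Q0.
Hypothesis stable : hausdorff_stable (zonotope Q0 mu0) p.

Local Notation Z0 := (zonotope Q0 mu0).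
Let ppi := nearest_pt p Z0.
Let u0 := p - ppi.
Let x0 := lift_pt Q0 mu0 ppi.
Let I0 := orth_gens Q0 u0.

Let Z0b : convex_body Z0. Proof. exact: convex_body_zonotope. Qed.

Let Z0pi : Z0 ppi. Proof. by have [] := nearest_pt_proj p Z0b. Qed.

Let ru0 : relint (normal_cone Z0 ppi) u0. Proof. exact: stable_relint. Qed.

Let x0c : cube x0. Proof. by have [] := lift_ptP Z0pi. Qed.

Let x0E : Q0 *m x0 + mu0 = ppi. Proof. by have [] := lift_ptP Z0pi. Qed.

Let normal_coneP u : normal_cone Z0 ppi u <->
  forall i, (x0 i 0 < 1 -> (Q0^T *m u) i 0 <= 0) /\ (0 < x0 i 0 -> 0 <= (Q0^T *m u) i 0).
Proof. by rewrite -x0E; exact: normal_cone_zonotopeP. Qed.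

Let faceE : smallest_face Z0 ppi = [set z | Z0 z /\ dot u0 z = dot u0 ppi].
Proof. exact: smallest_faceE. Qed.

Let Nu0 : normal_cone Z0 ppi u0. Proof. by case: ru0. Qed.

(** If the displacement vanishes, there still is a supporting normal [w] at [p], and
stability makes a negative multiple of [w] a normal as well, so that [w] is
orthogonal to all generators. *)
Lemma boundary_orth_gens : ~ Z0° p ->
  exists2 w, w != 0 & I0 \subset orth_gens Q0 w.
Proof.
move=> pnint; have [u00|] := eqVneq u0 0; last by exists u0.
have pE : p = ppi by apply/eqP; rewrite -subr_eq0 -/u0 u00.
have [w w0 Nw] := supporting_hyperplane pnint; rewrite pE in Nw.
have [e e0] := relint_normal_coneB ru0 Nw; rewrite u00 sub0r => New.
exists w => //; apply/fintype.subsetP => i _; rewrite inE.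
have [a1 a2] := (normal_coneP w).1 Nw i; have [b1 b2] := (normal_coneP _).1 New i.
have sE : (Q0^T *m - (e *: w)) i 0 = - (e * (Q0^T *m w) i 0).
  by rewrite mulmxN -scalemxAr [LHS]mxE [X in - X]mxE.
rewrite eq_le; have /andP[xi0 xi1] := x0c i.
have [xi|xi] := ltP (x0 i 0) 1.
  rewrite a1 //=; have := b1 xi; rewrite sE; nra.
have xi' : 0 < x0 i 0 by exact: lt_le_trans xi.
by rewrite a2 // andbT; have := b2 xi'; rewrite sE; nra.
Qed.

Lemma indep_I0 : ~ Z0° p -> indep_on Q0 I0.
Proof.
move=> /boundary_orth_gens[w w0 sub].
exact: indep_on_sub sub (general_position_indep_normal gp w0).
Qed.

(** Were a free coordinate of the lift at an end of its interval, [u0] could be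
tilted along a dual vector to another normal, one that favours this end strictly;
moving [u0] away from that normal would then favour the points inside, so the
result would no longer be a normal. *)
Lemma lift_strictly_inside : ~ Z0° p -> forall i, i \in I0 -> 0 < x0 i 0 < 1.
Proof.
move=> pnint i iI; have ind := indep_I0 pnint.
have tilt (c : R) : c != 0 -> (x0 i 0 < 1 -> c <= 0) -> (0 < x0 i 0 -> 0 <= c) -> False.
  move=> c0 c1 c2.
  have [e [w [e0 _ w0 wp wn]]] := perturb_normal (fun j => if j == i then c else 0) ind.
  have Nw : normal_cone Z0 ppi w.
    apply/normal_coneP => j; have [a1 a2] := (normal_coneP u0).1 Nu0 j.
    have [uj|uj|uj] := ltgtP ((Q0^T *m u0) j 0) 0.
    - split=> h; first exact/ltW/wn.
      by have := a2 h; lra.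
    - split=> h; last exact/ltW/wp.
      by have := a1 h; lra.
    - rewrite w0 //; case: eqP => [->|_]; last by rewrite mulr0.
      by rewrite pmulr_rle0 // pmulr_rge0.
  have [f f0 /normal_coneP/(_ i)] := relint_normal_coneB ru0 Nw.
  have -> : (Q0^T *m (u0 - f *: w)) i 0 = - (f * (e * c)).
    rewrite mulmxBr -scalemxAr [LHS]mxE [X in _ + X]mxE [X in _ - X]mxE.
    move: iI; rewrite inE => /eqP ui; rewrite ui w0 // eqxx; lra.
  have fe : 0 < f * e by exact: mulr_gt0.
  rewrite mulrA oppr_le0 oppr_ge0 pmulr_rge0 // pmulr_rle0 // => -[d1 d2].
  have /andP[xi0 xi1] := x0c i; move/eqP: c0; apply; apply/eqP; rewrite eq_le.
  have [xi|xi] := ltP (x0 i 0) 1; first by rewrite c1 //= d1.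
  have xi' : 0 < x0 i 0 by exact: lt_le_trans xi.
  by rewrite d2 //= c2.
have /andP[xi0 xi1] := x0c i; apply/andP; split; rewrite lt_neqAle ?xi0 ?xi1 andbT.
  by apply/eqP => xi; apply: (tilt (-1)); rewrite ?oppr_eq0 ?oner_neq0 // -xi ?ltxx //; lra.
by apply/eqP => xi; apply: (tilt 1); rewrite ?oner_neq0 // xi ?ltxx //; lra.
Qed.

Let face_coords x : cube x ->
  dot u0 (Q0 *m x + mu0) = dot u0 ppi <-> forall i, i \notin I0 -> x i 0 = x0 i 0.
Proof.
move=> xc; rewrite -x0E !dotDr.
have term i : 0 <= (x0 i 0 - x i 0) * (Q0^T *m u0) i 0.
  have [a1 a2] := (normal_coneP u0).1 Nu0 i.
  have /andP[xi0 xi1] := xc i; have /andP[yi0 yi1] := x0c i.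
  have [yi|yi] := ltP (x0 i 0) 1; last first.
    by have := a2 (lt_le_trans ltr01 yi); nra.
  have := a1 yi; have [yi'|yi'] := ltP 0 (x0 i 0); last by nra.
  by have := a2 yi'; nra.
split=> [/addIr|xx0]; last first.
  congr (_ + _); rewrite !dot_genE; apply: eq_bigr => i _.
  have [|/xx0 -> //] := boolP (i \in I0).
  by rewrite inE => /eqP ->; rewrite !mulr0.
rewrite !dot_genE => h i iI.
have : \sum_i (x0 i 0 - x i 0) * (Q0^T *m u0) i 0 == 0.
  by under eq_bigr do rewrite mulrBl; rewrite sumrB h subrr.
rewrite psumr_eq0 // => /allP/(_ i (mem_index_enum i)) /=.
rewrite mulf_eq0; move: iI; rewrite inE => /negbTE ->; rewrite orbF subr_eq0.
by move=> /eqP.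
Qed.

(** The first case is the convention for the improper face, in which [I0] contains
all generators.  In the other case the lifts of the points of the face are unique
by independence, so the pushforward moves the coordinates in [I0] freely. *)
Lemma aff_pushE Q mu : ~ Z0° p -> aff_push Q0 mu0 Q mu (smallest_face Z0 ppi) =
  flat (Q *m x0 + mu) (Q *m coord_proj R I0).
Proof.
move=> pnint; have inside := lift_strictly_inside pnint; have ind := indep_I0 pnint.
have small (y : 'cV[R]_n) : exists2 e : R, 0 < e & cube (x0 + e *: (coord_proj R I0 *m y)).
  (* the distance of the coordinate to the ends of the interval *)
  pose c i := if i \in I0 then Num.min (x0 i 0) (1 - x0 i 0) else 1.
  have c0 i : 0 < c i.
    by rewrite /c; case: ifPn => // /inside/andP[h1 h2]; rewrite lt_min h1 subr_gt0.
  have [e e0 ec] := small_multiple (fun i => `|y i 0|) c0.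
  exists e => // i; rewrite col_addZE coord_projE.
  case: ifPn => iI; last by rewrite mulr0 addr0.
  have := ec i; rewrite /c iI lt_min => /andP[h1 h2].
  have := ler_norm (y i 0); have := ler_norm (- y i 0); rewrite normrN => k1 k2.
  by apply/andP; split; nra.
rewrite /aff_push; case: asboolP => [FZ|_].
- have I0T i : i \in I0.
    apply/negPn/negP => iI.
    (* moving coordinate [i] to the opposite end of the interval leaves the face *)
    pose x := x0 + ((if x0 i 0 == 0 then 1 else 0) - x0 i 0) *: delta_mx i 0.
    have xi : x i 0 = if x0 i 0 == 0 then 1 else 0.
      by rewrite !mxE !eqxx mulr1 addrC subrK.
    have xc : cube x.
      move=> j; have [->|ji] := eqVneq j i.
        by rewrite xi; case: ifP; rewrite lexx ler01.
      by rewrite !mxE (negbTE ji) mulr0 addr0.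
    have : smallest_face Z0 ppi (Q0 *m x + mu0) by rewrite FZ; exists x.
    rewrite faceE => -[_ /(face_coords xc)/(_ i iI)]; rewrite xi.
    by case: eqP => [->|h0 h1]; [move/eqP; rewrite oner_eq0|exact: h0].
  have D1 (y : 'cV[R]_n) : coord_proj R I0 *m y = y.
    by apply/matrixP => i j; rewrite ord1 coord_projE I0T.
  apply: Aff_flat; first by exists x0.
    move=> _ [x _ <-]; exists (x - x0).
    by rewrite -mulmxA D1 mulmxBr [RHS]addrC addrA subrK.
  move=> y; have [e e0 ec] := small y; exists e => //.
  by exists (x0 + e *: (coord_proj R I0 *m y)) => //; rewrite -mulmxA mulmxDr -scalemxAr addrAC.
- have lift_face x : cube x -> (forall i, i \notin I0 -> x i 0 = x0 i 0) ->
      smallest_face Z0 ppi (Q0 *m x + mu0) /\ lift_pt Q0 mu0 (Q0 *m x + mu0) = x.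
    move=> xc xx0.
    have Fx : dot u0 (Q0 *m x + mu0) = dot u0 ppi by apply/face_coords.
    have Zx : Z0 (Q0 *m x + mu0) by exists x.
    split; first by rewrite faceE.
    have [lc lE] := lift_ptP Zx; set l := lift_pt _ _ _ in lc lE *.
    have lx0 : forall i, i \notin I0 -> l i 0 = x0 i 0.
      by apply/face_coords => //; rewrite lE.
    apply/eqP; rewrite -subr_eq0; apply/eqP; apply: ind => [i iI|].
      by rewrite !mxE lx0 // xx0 // subrr.
    by rewrite mulmxBr; move/addIr: lE => ->; rewrite subrr.
  have in_push x : cube x -> (forall i, i \notin I0 -> x i 0 = x0 i 0) ->
      (zpushforward Q0 mu0 Q mu @` smallest_face Z0 ppi) (Q *m x + mu).
    move=> xc xx0; have [Fx lx] := lift_face x xc xx0.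
    by exists (Q0 *m x + mu0) => //; rewrite /zpushforward lx.
  apply: Aff_flat; first exact: in_push.
    move=> _ [z Fz <-]; move: Fz; rewrite faceE => -[Zz zu]; have [lc lE] := lift_ptP Zz.
    exists (lift_pt Q0 mu0 z - x0); rewrite /zpushforward -mulmxA.
    have -> : coord_proj R I0 *m (lift_pt Q0 mu0 z - x0) = lift_pt Q0 mu0 z - x0.
      apply/matrixP => i j; rewrite ord1 coord_projE; case: ifPn => // iI.
      rewrite !mxE; have -> : lift_pt Q0 mu0 z i 0 = x0 i 0; last by rewrite subrr.
      by move: i iI; apply/face_coords => //; rewrite lE.
    by rewrite mulmxBr [RHS]addrC addrA subrK.
  move=> y; have [e e0 ec] := small y; exists e => //.
  rewrite -mulmxA addrAC scalemxAr -mulmxDr; apply: in_push => // i iI.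
  by rewrite col_addZE coord_projE (negbTE iI) mulr0 addr0.
Qed.

(** Near [(Q0, mu0)] the orthogonal projection of [p] on the flat has coordinates
[x0 + y Z] with [y] continuous and 0 at [(Q0, mu0)], so it stays in the zonotope,
and the residual [r] stays an outer normal there.  If [r] vanishes at
[(Q0, mu0)] although [p] is not interior, all generators lie in a hyperplane and
the zonotope has no interior. *)
Lemma term_P_near : local_sqrt_rational (Q0, mu0) (term_P Q0 mu0 p)
  (fun Z => dist p (zonotope Z.1 Z.2)) (~ Z0 p \/ Z0° !=set0).
Proof.
have [pint|pnint] := pselect (Z0° p).
  have Zp : Z0 p by exact: interior_subset pint.
  have ppiE : ppi = p by exact: nearest_pt_id.
  have FE : smallest_face Z0 ppi = Z0.
    rewrite faceE /u0 ppiE subrr; apply/seteqP; split=> [z []//|z Zz].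
    by rewrite /= !dot0l.
  have near0 : \forall Z \near (Q0, mu0),
      term_P Q0 mu0 p Z.1 Z.2 = 0 /\ dist p (zonotope Z.1 Z.2) = 0.
    have := interior_zonotope_near pint; apply: filterS => Z Zint.
    have {}Zint : zonotope Z.1 Z.2 p by exact: interior_subset Zint.
    split; last exact: dist_in.
    by rewrite /term_P /aff_push -/ppi FE asboolT // dist_in //; exact: Aff_sub.
  exists (fun=> 0); split=> //; first exact: rational_cst.
  - by apply: filterS near0 => Z [-> _]; rewrite sqrtr0.
  - by move=> _; right; near=> Z.
  - by apply: filterS near0 => Z [-> ->].
have ind := indep_I0 pnint; have inside := lift_strictly_inside pnint.
pose w (Z : T) := p - (Z.1 *m x0 + Z.2).
pose r (Z : T) := residual Z.1 I0 (w Z).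
pose y (Z : T) := residual_coord Z.1 I0 (w Z).
have w0 : w (Q0, mu0) = u0 by rewrite /w x0E.
have y0 : y (Q0, mu0) = 0.
  by apply: residual_coord0 => i; rewrite w0 inE => /eqP.
have r0 : r (Q0, mu0) = u0 by rewrite /r /residual -/(y (Q0, mu0)) y0 mulmx0 subr0.
have rw : rational_mx (Q0, mu0) w.
  apply: rational_mxB; first exact: rational_mx_cst.
  apply: rational_mxD; last exact: rational_mx_shift.
  by apply: rational_mxM; [exact: rational_mx_gen|exact: rational_mx_cst].
have rr : rational_mx (Q0, mu0) r by exact: rational_residual.
have ry : rational_mx (Q0, mu0) y by exact: rational_residual_coord.
have unit_near := @gram_unit_near _ _ _ (Q0, mu0) _ ind.
have rE Z : r Z = p - (Z.1 *m x0 + Z.2 + Z.1 *m y Z) by rewrite /r /residual opprD addrA.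
have term_near : \forall Z \near (Q0, mu0), term_P Q0 mu0 p Z.1 Z.2 = enorm (r Z).
  apply: filterS unit_near => Z Hu; rewrite /term_P aff_pushE //.
  have yD : Z.1 *m y Z = Z.1 *m coord_proj R I0 *m y Z.
    by rewrite /y /residual_coord -[RHS]mulmxA [in RHS](mulmxA (coord_proj R I0)) coord_proj_idem.
  rewrite rE yD; apply: dist_flat; rewrite -yD -rE trmx_mul tr_coord_proj -mulmxA.
  apply/matrixP => i j; rewrite ord1 coord_projE [RHS]mxE; case: ifPn => // iI.
  exact: residual_orth.
have dist_near : \forall Z \near (Q0, mu0), dist p (zonotope Z.1 Z.2) = enorm (r Z).
  have cube_near : \forall Z \near (Q0, mu0), forall i, i \in I0 ->
      0 < x0 i 0 + y Z i 0 < 1.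
    apply: near_forall => i; have [iI|iI] := boolP (i \in I0); last by near=> Z.
    have yc : {for (Q0, mu0), continuous (fun Z => x0 i 0 + y Z i 0)}.
      apply: rational_continuous; apply: rationalD; first exact: rational_cst.
      exact: ry.
    have /andP[lt0 lt1] := inside i iI.
    have h0 : \forall Z \near (Q0, mu0), 0 < x0 i 0 + y Z i 0.
      by apply: near_lt; [exact: cst_continuous| |rewrite y0 mxE addr0].
    have h1 : \forall Z \near (Q0, mu0), x0 i 0 + y Z i 0 < 1.
      by apply: near_lt; [|exact: cst_continuous|rewrite y0 mxE addr0].
    by apply: filterS2 h0 h1 => Z -> ->.
  have sgn_near : \forall Z \near (Q0, mu0), forall i,
      (0 < (Q0^T *m u0) i 0 -> 0 < (Z.1^T *m r Z) i 0) /\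
      ((Q0^T *m u0) i 0 < 0 -> (Z.1^T *m r Z) i 0 < 0).
    apply: near_forall => i.
    have rm : rational_mx (Q0, mu0) (fun Z : T => Z.1^T *m r Z).
      by apply: rational_mxM => //; apply: rational_trmx; exact: rational_mx_gen.
    have sc : {for (Q0, mu0), continuous (fun Z : T => (Z.1^T *m r Z) i 0)}.
      by apply: rational_continuous; exact: rm.
    have [ui|ui|ui] := ltgtP ((Q0^T *m u0) i 0) 0.
    - have : \forall Z \near (Q0, mu0), (Z.1^T *m r Z) i 0 < 0.
        by apply: near_lt; [|exact: cst_continuous|rewrite r0].
      by apply: filterS.
    - have : \forall Z \near (Q0, mu0), 0 < (Z.1^T *m r Z) i 0.
        by apply: near_lt; [exact: cst_continuous| |rewrite r0].
      by apply: filterS.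
    - by near=> Z.
  near=> Z.
  have Hu : gram Z.1 I0 \in unitmx by near: Z.
  have cZ : forall i, i \in I0 -> 0 < x0 i 0 + y Z i 0 < 1 by near: Z.
  have sZ : forall i, (0 < (Q0^T *m u0) i 0 -> 0 < (Z.1^T *m r Z) i 0) /\
      ((Q0^T *m u0) i 0 < 0 -> (Z.1^T *m r Z) i 0 < 0) by near: Z.
  have xyc : cube (x0 + y Z).
    move=> i; rewrite mxE; have [iI|iI] := boolP (i \in I0).
      by have /andP[/ltW -> /ltW ->] := cZ i iI.
    by rewrite residual_coord_out // addr0.
  have rE' : r Z = p - (Z.1 *m (x0 + y Z) + Z.2) by rewrite rE mulmxDr addrAC.
  rewrite rE'; apply: dist_proj; split; first by exists (x0 + y Z).
  rewrite -rE'; apply/normal_cone_zonotopeP => // i.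
  have [iI|iI] := boolP (i \in I0); first by rewrite residual_orth.
  rewrite [(x0 + y Z) i 0]mxE residual_coord_out // addr0.
  have [a1 a2] := (normal_coneP u0).1 Nu0 i; have [s1 s2] := sZ i.
  have [ui|ui|ui] := ltgtP ((Q0^T *m u0) i 0) 0.
  - split=> xi; first exact/ltW/s2.
    by have := a2 xi; lra.
  - split=> xi; last exact/ltW/s1.
    by have := a1 xi; lra.
  - by move: iI; rewrite inE ui eqxx.
exists (fun Z => dot (r Z) (r Z)); split.
- exact: rational_dot.
- by move=> Z; exact: dot_ge0.
- exact: term_near.
- move=> reg; left; rewrite r0 dot_gt0; apply/eqP => u00.
  have pE : p = ppi by apply/eqP; rewrite -subr_eq0 -/u0 u00.
  case: reg => [|[z zint]]; first by rewrite pE.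
  have [v v0 sub] := boundary_orth_gens pnint.
  have [x xc zE] := interior_subset zint.
  move/eqP: v0; apply; apply: interior_normal0 zint _; rewrite -zE.
  have orth t : dot v (Q0 *m t) = 0.
    rewrite dot_genE big1 // => i _.
    have : i \in orth_gens Q0 v.
      by apply: (fintype.subsetP sub); rewrite inE u00 mulmx0 mxE.
    by rewrite inE => /eqP ->; rewrite mulr0.
  by move=> _ [t tc <-]; rewrite opprD addrACA subrr addr0 dotBr !orth subrr.
- by apply: filterS2 term_near dist_near => Z -> ->.
Unshelve. all: by end_near. Qed.

End PolytopeVertexTerm.

(** * The term of a vertex of the zonotope *)

Section ZonotopeVertexTerm.
Variables (R : realType) (d n m : nat).
Local Notation T := ('M[R]_(d, n) * 'cV[R]_d)%type.
Variables (v : 'I_m.+1 -> 'cV[R]_d).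
Variables (Q0 : 'M[R]_(d, n)) (mu0 q : 'cV[R]_d).
Local Notation P := (hull v).
Hypothesis Zq : zonotope Q0 mu0 q.
Hypothesis stable : hausdorff_stable P q.

Let qpi := nearest_pt q P.
Let u0 := q - qpi.
Let J i := dot u0 (v i) == dot u0 qpi.

Let Pb : convex_body P. Proof. exact: convex_body_hull. Qed.

Let Ppi : P qpi. Proof. by have [] := nearest_pt_proj q Pb. Qed.

Let ru0 : relint (normal_cone P qpi) u0. Proof. exact: stable_relint. Qed.

Let faceE : smallest_face P qpi = [set z | P z /\ dot u0 z = dot u0 qpi].
Proof. exact: smallest_faceE. Qed.

Let u0v i : dot u0 (v i) <= dot u0 qpi.
Proof. by have [Nu _] := ru0; have := Nu _ (hull_gen v i); rewrite dotBr subr_le0. Qed.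

(** The directions of the exposed face; the columns outside of it are 0, so that
the index set is that of the generators. *)
Definition face_dirs : 'M[R]_(d, m.+1) :=
  \matrix_(k, i) (if J i then (v i - qpi) k 0 else 0).
Local Notation W := face_dirs.

Lemma col_face_dirs i : col i W = if J i then v i - qpi else 0.
Proof. by apply/matrixP => k l; rewrite ord1 !mxE; case: ifP => _; rewrite !mxE. Qed.

Lemma face_dirsE c : W *m c = \sum_(i | J i) c i 0 *: (v i - qpi).
Proof.
rewrite mulmx_cols [RHS]big_mkcond; apply: eq_bigr => i _.
by rewrite col_face_dirs; case: ifP => _; rewrite ?scaler0.
Qed.

Lemma dot_face_dirs c : dot u0 (W *m c) = 0.
Proof.
rewrite face_dirsE dot_sumr big1 // => i /eqP Ji.
by rewrite dotZr dotBr Ji subrr mulr0.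
Qed.

Lemma face_dirs_orth u i : W^T *m u = 0 -> J i -> dot u (v i) = dot u qpi.
Proof.
move=> Wu Ji; have : dot (col i W) u = 0 by rewrite -col_genE Wu mxE.
by rewrite col_face_dirs Ji dotC dotBr => /eqP; rewrite subr_eq0 => /eqP.
Qed.

(** Moving from [qpi] by [W *m c] changes the weight of [v i] in the face from [a i] to
[a i + c i - s * a i], where [s] is the sum of the [c j] over the face. *)
Lemma hull_add_dirs a (c : 'cV[R]_m.+1) : (forall i, 0 <= a i) -> \sum_i a i = 1 ->
  qpi = \sum_i a i *: v i -> (forall i, 0 < a i <-> dot u0 (v i) = dot u0 qpi) ->
  (forall i, J i -> 0 <= a i + c i 0 - (\sum_(j | J j) c j 0) * a i) ->
  P (qpi + W *m c).
Proof.
move=> a0 a1 qa aJ h; set s := \sum_(j | J j) c j 0 in h.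
exists (fun i => a i + (if J i then c i 0 else 0) - s * a i); split.
- move=> i; case: ifPn => [|Ji]; first exact: h.
  have -> : a i = 0; last by rewrite mulr0 addr0 subr0.
  apply/eqP; rewrite eq_le a0 andbT leNgt; apply/negP => /aJ/eqP.
  by move: Ji; rewrite /J => /negbTE ->.
- rewrite sumrB big_split /= -mulr_sumr a1 mulr1 -big_mkcond /=.
  by rewrite addrK.
- under eq_bigr do rewrite scalerBl scalerDl -scalerA.
  rewrite sumrB big_split /= -scaler_sumr -qa -addrA; congr (_ + _).
  rewrite face_dirsE /s scaler_suml.
  transitivity (\sum_(i | J i) c i 0 *: v i - \sum_(i | J i) c i 0 *: qpi).
    by rewrite -sumrB; apply: eq_bigr => i _; rewrite scalerBr.
  congr (_ - _); rewrite big_mkcond; apply: eq_bigr => i _.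
  by case: ifP; rewrite ?scale0r.
Qed.

Lemma Aff_faceE : Aff (smallest_face P qpi) = flat qpi W.
Proof.
have [a [a0 a1 qa aJ]] := relint_positive_weights Ppi ru0.
apply: Aff_flat; rewrite faceE; first by split.
  move=> _ [[b [b0 b1 ->]] ub]; exists (\col_i b i); rewrite face_dirsE.
  have bJ i : ~~ J i -> b i = 0.
    have : \sum_j b j * (dot u0 qpi - dot u0 (v j)) == 0.
      under eq_bigr do rewrite mulrBr -!dotZr.
      by rewrite sumrB -!dot_sumr ub -scaler_suml b1 scale1r subrr.
    rewrite psumr_eq0 => [/allP /(_ i (mem_index_enum i))|j _].
      by rewrite mulf_eq0 subr_eq0 [_ == dot u0 (v i)]eq_sym -/(J i) => /orP[/eqP//|->].
    by rewrite mulr_ge0 // subr_ge0.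
  have -> : \sum_(i | J i) (\col_j b j) i 0 *: (v i - qpi) = \sum_i b i *: (v i - qpi).
    rewrite [LHS]big_mkcond; apply: eq_bigr => i _; rewrite mxE.
    by case: ifPn => // /bJ ->; rewrite scale0r.
  under [in RHS]eq_bigr do rewrite scalerBr.
  by rewrite sumrB -scaler_suml b1 scale1r addrC subrK.
move=> y.
have c0 i : 0 < if J i then a i else 1 by case: ifP => // /eqP /aJ.
have [e e0 ec] := small_multiple (fun i => (\sum_(j | J j) y j 0) * a i - y i 0) c0.
exists e => //; split; last by rewrite dotDr dotZr dot_face_dirs mulr0 addr0.
rewrite scalemxAr; apply: (hull_add_dirs a0 a1 qa aJ) => i Ji.
under eq_bigr do rewrite mxE; rewrite -mulr_sumr mxE.
by have := ec i; rewrite Ji; nra.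
Qed.

(** The projection of the pushed forward vertex on the flat is [qpi + W *m c Z],
where [c] is continuous and 0 at [(Q0, mu0)]; so it keeps positive weights and
stays in [P], while the generators outside the face stay strictly behind. *)
Lemma term_Z_near : local_sqrt_rational (Q0, mu0) (term_Z Q0 mu0 P q)
  (fun Z => dist (zpushforward Q0 mu0 Z.1 Z.2 q) P) (~ P q \/ P° !=set0).
Proof.
have [lc lE] := lift_ptP Zq.
have [a [a0 a1 qa aJ]] := relint_positive_weights Ppi ru0.
have [M WM] := normal_equations W.
pose y (Z : T) := zpushforward Q0 mu0 Z.1 Z.2 q.
(* [W *m M] projects on the span of [W]; applying it twice makes [c] vanish at
   [(Q0, mu0)], which [M *m u0] alone need not do *)
pose c (Z : T) := M *m (W *m (M *m (y Z - qpi))).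
pose r (Z : T) := y Z - (qpi + W *m c Z).
have y0 : y (Q0, mu0) = q by exact: lE.
have Wu0 : W^T *m u0 = 0.
  apply/matrixP => i j; rewrite ord1 col_genE dotC.
  by rewrite colE dot_face_dirs mxE.
have WMx (x : 'cV[R]_d) : W^T *m (W *m (M *m x)) = W^T *m x.
  by rewrite [W *m (M *m x)]mulmxA mulmxA WM.
have WMu0 : W *m (M *m u0) = 0.
  by apply/eqP; rewrite -dot_eq0 dot_mulmx WMx Wu0 dot0r.
have c0 : c (Q0, mu0) = 0 by rewrite /c y0 -/u0 WMu0 mulmx0.
have r0 : r (Q0, mu0) = u0 by rewrite /r c0 y0 mulmx0 addr0.
have Wr Z : W^T *m r Z = 0.
  by rewrite /r opprD addrA mulmxBr /c !WMx subrr.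
have ry : rational_mx (Q0, mu0) y.
  apply: rational_mxD; last exact: rational_mx_shift.
  by apply: rational_mxM; [exact: rational_mx_gen|exact: rational_mx_cst].
have rc : rational_mx (Q0, mu0) c.
  do 3![apply: rational_mxM; first exact: rational_mx_cst].
  by apply: rational_mxB => //; exact: rational_mx_cst.
have rW : rational_mx (Q0, mu0) (fun Z => qpi + W *m c Z).
  apply: rational_mxD; first exact: rational_mx_cst.
  by apply: rational_mxM => //; exact: rational_mx_cst.
have rr : rational_mx (Q0, mu0) r by exact: rational_mxB.
have termE Z : term_Z Q0 mu0 P q Z.1 Z.2 = enorm (r Z).
  by rewrite /term_Z Aff_faceE; apply: dist_flat; exact: Wr.
have weights_near : \forall Z \near (Q0, mu0), forall i, J i ->
    0 < a i + c Z i 0 - (\sum_(j | J j) c Z j 0) * a i.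
  apply: near_forall => i; have [Ji|Ji] := boolP (J i); last by near=> Z.
  have : \forall Z \near (Q0, mu0),
      0 < a i + c Z i 0 + (- a i) * (\sum_(j | J j) c Z j 0).
    apply: near_lt; first exact: cst_continuous.
      apply: rational_continuous; apply: rationalD.
        by apply: rationalD; [exact: rational_cst|exact: rc].
      apply: rationalM; first exact: rational_cst.
      by apply: rational_sum => j; exact: rc.
    rewrite c0 mxE addr0 big1 => [|j _]; last by rewrite mxE.
    by rewrite mulr0 addr0; apply/aJ/eqP.
  by apply: filterS => Z h _; move: h; rewrite mulNr mulrC.
have side_near : \forall Z \near (Q0, mu0), forall i, ~~ J i ->
    dot (r Z) (v i) < dot (r Z) (qpi + W *m c Z).
  apply: near_forall => i; have [Ji|Ji] := boolP (J i); first by near=> Z.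
  have : \forall Z \near (Q0, mu0), dot (r Z) (v i) < dot (r Z) (qpi + W *m c Z).
    apply: near_lt.
    - by apply: rational_continuous; apply: rational_dot => //; exact: rational_mx_cst.
    - by apply: rational_continuous; exact: rational_dot.
    - by rewrite r0 c0 mulmx0 addr0 lt_neqAle u0v andbT; exact: Ji.
  by apply: filterS.
exists (fun Z => dot (r Z) (r Z)); split.
- exact: rational_dot.
- by move=> Z; exact: dot_ge0.
- by near=> Z; exact: termE.
- move=> reg; have [u00|] := eqVneq u0 0; last by left; rewrite r0 dot_gt0.
  have qE : q = qpi by apply/eqP; rewrite -subr_eq0 -/u0 u00.
  case: reg => [|[z zint]]; first by rewrite qE.
  have zP := interior_subset zint.
  right; near=> Z; have -> : r Z = 0; last exact: dot0r.
  apply: interior_normal0 zint _.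
  have rv t : P t -> dot (r Z) t = dot (r Z) qpi.
    move=> [b [_ b1 ->]]; rewrite dot_sumr -[RHS]mul1r -b1 mulr_suml.
    apply: eq_bigr => i _; rewrite dotZr (face_dirs_orth (Wr Z)) //.
    by rewrite /J u00 !dot0l.
  by move=> t Pt; rewrite dotBr (rv t Pt) (rv z zP) subrr.
- near=> Z; rewrite termE; apply: dist_proj; split.
    apply: (hull_add_dirs a0 a1 qa aJ) => i Ji; apply: ltW; move: i Ji.
    by near: Z.
  move=> t Pt; rewrite dotBr subr_le0; apply: hull_le_dot Pt => i.
  have [Ji|Ji] := boolP (J i); last first.
    by apply: ltW; move: i Ji; near: Z.
  by rewrite (face_dirs_orth (Wr Z)) // dotDr [dot _ (W *m _)]dotC dot_mulmx Wr dot0r addr0.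
Unshelve. all: by end_near. Qed.

End ZonotopeVertexTerm.

(** * The Hausdorff distance near a stable zonotope *)

Lemma finite_common_nbhs (T : topologicalType) (I : finType) (Z0 : T)
    (Pr : I -> set T -> Prop) :
  (forall i U V, V `<=` U -> Pr i U -> Pr i V) ->
  (forall i, exists2 U, nbhs Z0 U & Pr i U) ->
  exists2 U, nbhs Z0 U & forall i, Pr i U.
Proof.
move=> anti ex.
have /choice[F FP] : forall i, exists U, nbhs Z0 U /\ Pr i U.
  by move=> i; have [U] := ex i; exists U.
exists [set Z | forall i, F i Z].
  by apply: near_forall => i; have [] := FP i.
by move=> i; apply: anti (FP i).2 => Z; exact.
Qed.

Lemma eq_sup_dominated (R : realType) (A B : set R) :
  (forall a, A a -> exists2 b, B b & a <= b) ->
  (forall b, B b -> exists2 a, A a & b <= a) -> sup A = sup B.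
Proof.
move=> AB BA; rewrite -sup_down -[RHS]sup_down; congr sup.
apply/seteqP; split=> x /downP[y Yy xy]; apply/downP.
  by have [b Bb yb] := AB y Yy; exists b => //; exact: le_trans yb.
by have [a Aa ya] := BA y Yy; exists a => //; exact: le_trans ya.
Qed.

Lemma Vert_zonotope (R : realType) (d n : nat) (Q : 'M[R]_(d, n)) mu q :
  Vert (zonotope Q mu) q -> exists e : {set 'I_n}, q = Q *m corner R e + mu.
Proof.
move=> [u fq]; pose e : {set 'I_n} := [set i | 0 <= (Q^T *m u) i 0]%SET.
exists e; apply/esym; have -> // : [set q] (Q *m corner R e + mu).
rewrite fq; split; first by exists (corner R e) => //; exact: cube_corner.
move=> _ [x xc <-]; rewrite !dotDr lerD2r !dot_genE; apply: ler_sum => i _.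
rewrite [corner R e i 0]mxE inE; have /andP[x0 x1] := xc i.
by case: (leP 0 ((Q^T *m u) i 0)) => h; nra.
Qed.

Section Neighborhoods.
Variables (R : realType) (d n : nat).
Local Notation T := ('M[R]_(d, n) * 'cV[R]_d)%type.

Lemma local_sqrt_rational_nbhs (Z0 : T) t h reg :
  local_sqrt_rational Z0 t h reg ->
  exists2 U, nbhs Z0 U &
    sqrt_rational_term U t reg /\ forall Z, U Z -> h Z = t Z.1 Z.2.
Proof.
move=> [g [rg g0 tg greg ht]].
have [U nU [Us Ud]] := sqrt_rational_near rg g0 tg greg.
exists (U `&` [set Z | h Z = t Z.1 Z.2]); first exact: filterI.
split; last by move=> Z [].
split; last by move=> /Ud Udiff Z [/Udiff].
have [N [D [M H]]] := Us; exists N, D, M => Q mu [UZ _]; exact: H.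
Qed.

Lemma sqrt_rational_term_sub (U V : set T) t reg : V `<=` U ->
  sqrt_rational_term U t reg -> sqrt_rational_term V t reg.
Proof.
move=> VU [[N [D [M H]]] Ud]; split; last by move=> /Ud Udiff Z /VU/Udiff.
by exists N, D, M => Q mu /VU; exact: H.
Qed.

End Neighborhoods.

Unset Implicit Arguments.

Theorem theorem4p7 (R : realType) (d n : nat) (P : set 'cV[R]_d)
    (Q0 : 'M[R]_(d, n)) (mu0 : 'cV[R]_d) :
  is_polytope P ->
  general_position Q0 ->
  (forall p, Vert P p -> hausdorff_stable (zonotope Q0 mu0) p) ->
  (forall q, Vert (zonotope Q0 mu0) q -> hausdorff_stable P q) ->
  exists U : set ('M[R]_(d, n) * 'cV[R]_d),
    [/\ open U /\ U (Q0, mu0),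
        forall Q mu, U (Q, mu) ->
          (forall q, frontier (zonotope Q0 mu0) q ->
             frontier (zonotope Q mu) (zpushforward Q0 mu0 Q mu q)) /\
          hausdorff_dist P (zonotope Q mu) =
            Num.max
              (sup [set term_P Q0 mu0 p Q mu | p in Vert P])
              (sup [set term_Z Q0 mu0 P q Q mu | q in Vert (zonotope Q0 mu0)]),
        forall p, Vert P p ->
          sqrt_bounded_rational U (term_P Q0 mu0 p) /\
          (~ zonotope Q0 mu0 p \/ (zonotope Q0 mu0)° !=set0 ->
           forall Z, U Z ->
             differentiable
               (fun Z : 'M[R]_(d, n) * 'cV[R]_d => term_P Q0 mu0 p Z.1 Z.2) Z)
      & forall q, Vert (zonotope Q0 mu0) q ->
          sqrt_bounded_rational U (term_Z Q0 mu0 P q) /\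
          (~ P q \/ P° !=set0 ->
           forall Z, U Z ->
             differentiable
               (fun Z : 'M[R]_(d, n) * 'cV[R]_d => term_Z Q0 mu0 P q Z.1 Z.2) Z)].
Proof.
move=> [m [v PE]] gp stP stZ.
have {}PE : P = hull v := PE; subst P.
set P := hull v in stP stZ *; set Z0 := zonotope Q0 mu0 in stP stZ *.
have Pb : convex_body P by exact: convex_body_hull.
have [UP nUP HP] : exists2 U, nbhs (Q0, mu0) U & forall i, Vert P (v i) ->
    sqrt_rational_term U (term_P Q0 mu0 (v i)) (~ Z0 (v i) \/ Z0° !=set0) /\
    forall Z, U Z -> dist (v i) (zonotope Z.1 Z.2) = term_P Q0 mu0 (v i) Z.1 Z.2.
  apply: finite_common_nbhs => [i U V VU h /h[h1 h2]|i].
    by split; [exact: sqrt_rational_term_sub h1|move=> Z /VU; exact: h2].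
  have [Vi|nVi] := pselect (Vert P (v i)).
    have [U nU HU] := local_sqrt_rational_nbhs (term_P_near gp (stP _ Vi)).
    by exists U.
  by exists setT => //; exact: filterT.
pose ve (e : {set 'I_n}) := Q0 *m corner R e + mu0.
have [UZ nUZ HZ] : exists2 U, nbhs (Q0, mu0) U & forall e, Vert Z0 (ve e) ->
    sqrt_rational_term U (term_Z Q0 mu0 P (ve e)) (~ P (ve e) \/ P° !=set0) /\
    forall Z, U Z -> dist (zpushforward Q0 mu0 Z.1 Z.2 (ve e)) P =
                     term_Z Q0 mu0 P (ve e) Z.1 Z.2.
  apply: finite_common_nbhs => [e U V VU h /h[h1 h2]|e].
    by split; [exact: sqrt_rational_term_sub h1|move=> Z /VU; exact: h2].
  have Ze : Z0 (ve e) by exists (corner R e) => //; exact: cube_corner.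
  have [Ve|nVe] := pselect (Vert Z0 (ve e)).
    have [U nU HU] := local_sqrt_rational_nbhs (term_Z_near Ze (stZ _ Ve)).
    by exists U.
  by exists setT => //; exact: filterT.
have dom := @vertices_dominate_near _ _ _ Q0 mu0 gp.
have proper := @proper_near _ _ _ Q0 mu0 gp.
pose good : set ('M[R]_(d, n) * 'cV[R]_d) := UP `&` UZ `&` [set Z | (forall u, u != 0 ->
    exists2 q, Vert Z0 q &
      forall z, zonotope Z.1 Z.2 z -> dot u z <= dot u (zpushforward Q0 mu0 Z.1 Z.2 q)) /\
    (forall q, frontier Z0 q -> frontier (zonotope Z.1 Z.2) (zpushforward Q0 mu0 Z.1 Z.2 q))].
have good_near : nbhs (Q0, mu0) good.
  apply: filterI; first exact: filterI.
  by apply: filterI.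
have goodUP : good° `<=` UP by move=> Z /interior_subset[[]].
have goodUZ : good° `<=` UZ by move=> Z /interior_subset[[]].
have VertPE p : Vert P p -> exists i, p = v i by exact: Vert_hull.
have VertZE q : Vert Z0 q -> exists e, q = ve e by exact: Vert_zonotope.
exists good°; split.
- by split; [exact: open_interior|].
- move=> Q mu Ug; have [_ [domZ properZ]] := interior_subset Ug.
  split; first exact: properZ.
  have Zb : convex_body (zonotope Q mu) by exact: convex_body_zonotope.
  have termP p : Vert P p -> dist p (zonotope Q mu) = term_P Q0 mu0 p Q mu.
    move=> Vp; have [i pE] := VertPE p Vp; rewrite pE in Vp *.
    by have [_ /(_ (Q, mu))] := HP i Vp; apply; exact: goodUP.
  have termZ q : Vert Z0 q ->
      dist (zpushforward Q0 mu0 Q mu q) P = term_Z Q0 mu0 P q Q mu.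
    move=> Vq; have [e qE] := VertZE q Vq; rewrite qE in Vq *.
    by have [_ /(_ (Q, mu))] := HZ e Vq; apply; exact: goodUZ.
  rewrite /hausdorff_dist; congr Num.max; apply: eq_sup_dominated.
  + move=> _ [x Px <-]; have xy := nearest_pt_proj x Zb.
    have [p Vp xp] := vertex_maximizing (x - nearest_pt x (zonotope Q mu)) Px.
    exists (term_P Q0 mu0 p Q mu); first by exists p.
    by rewrite -termP //; exact: le_dist_direction xy xp.
  + move=> _ [p Vp <-]; exists (dist p (zonotope Q mu)); last by rewrite termP.
    by exists p => //; have [i ->] := VertPE p Vp; exact: hull_gen.
  + move=> _ [z Zz <-]; have zy := nearest_pt_proj z Pb.
    have [z0|z0] := eqVneq (z - nearest_pt z P) 0.
      have [q Vq] := Vert_nonempty (convex_body_zonotope Q0 mu0).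
      exists (term_Z Q0 mu0 P q Q mu); first by exists q.
      rewrite -termZ // (dist_proj zy) z0 enorm0.
      by rewrite (dist_proj (nearest_pt_proj _ Pb)) enorm_ge0.
    have [q Vq zq] := domZ _ z0; exists (term_Z Q0 mu0 P q Q mu); first by exists q.
    by rewrite -termZ //; apply: le_dist_direction zy _ => //; exact: zq.
  + move=> _ [q Vq <-].
    exists (dist (zpushforward Q0 mu0 Q mu q) P); last by rewrite termZ.
    exists (zpushforward Q0 mu0 Q mu q) => //; apply: zpushforward_in.
    have [e ->] := VertZE q Vq; exists (corner R e) => //; exact: cube_corner.
- move=> p Vp; have [i pE] := VertPE p Vp; rewrite pE in Vp *.
  by have [h _] := HP i Vp; exact: sqrt_rational_term_sub goodUP h.
- move=> q Vq; have [e qE] := VertZE q Vq; rewrite qE in Vq *.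
  by have [h _] := HZ e Vq; exact: sqrt_rational_term_sub goodUZ h.
Qed.
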